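(* Let $1\le p<\infty$, $0<\alpha<\frac{\gamma}{p}$, $p<q<\infty$, and let $\varphi(x,t)$ be a positive measurable function on $\mathbb{R}^n\times(0,\infty)$ satisfying $$\sup_{r<t<\infty}t^{-\gamma}\operatorname*{ess\,inf}_{t<\tau<\infty}\varphi(x,\tau)\,\tau^{\gamma}\le C\varphi(x,r)$$ and $$\int_r^\infty t^{\alpha}\varphi(x,t)^{\frac1p}\,\frac{dt}{t}\le C r^{-\frac{\alpha p}{q-p}},$$ where $C$ does not depend on $x\in\mathbb{R}^n$ and $r>0$. Then the operators $M^P_{\alpha}$ and $I^P_{\alpha}$ are bounded from $M_{p,\varphi^{1/p},P}$ to $M_{q,\varphi^{1/q},P}$ for $p>1$ and from $M_{1,\varphi,P}$ to $WM_{q,\varphi^{1/q},P}$ for $p=1$.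
   Context: Setting. $n\ge2$; $P$ is a real $n\times n$ matrix all of whose eigenvalues have positive real part; $A_t=t^P$ ($t>0$); $\gamma=\operatorname{tr}P$. $\rho$ is a quasi-distance associated with $P$: $\rho(A_tx)=t\rho(x)$ for $t>0$, $x\in\mathbb{R}^n$; $\rho(0)=0$, $\rho(x-y)=\rho(y-x)\ge0$ (with $\rho(x)>0$ for $x\neq0$), and $\rho(x-y)\le k(\rho(x-z)+\rho(y-z))$ for a constant $k$; and $dx=\rho^{\gamma-1}d\sigma(w)\,d\rho$ where $\rho=\rho(x)$, $w=A_{\rho^{-1}}x$ and $d\sigma(w)$ is a measure on $\{w:\rho(w)=1\}$. The ellipsoid is $E(x,r)=\{y\in\mathbb{R}^n:\rho(x-y)<r\}$; its Lebesgue measure is $|E(x,r)|=\upsilon_\rho r^\gamma$, where $\upsilon_\rho$ is the volume of the unit ellipsoid. Operators: $M^P_{\alpha}f(x)=\sup_{t>0}|E(x,t)|^{-1+\frac{\alpha}{\gamma}}\int_{E(x,t)}|f(y)|\,dy$ and $I^P_{\alpha}f(x)=\int_{\mathbb{R}^n}\frac{f(y)}{\rho(x-y)^{\gamma-\alpha}}\,dy$. Spaces. For $\psi(x,r)$ positive measurable on $\mathbb{R}^n\times(0,\infty)$ and $1\le p<\infty$, $M_{p,\psi,P}$ is the set of $f\in L_p^{loc}(\mathbb{R}^n)$ with $\|f\|_{M_{p,\psi,P}}=\sup_{x\in\mathbb{R}^n,\,r>0}\psi(x,r)^{-1}|E(x,r)|^{-1/p}\|f\|_{L_p(E(x,r))}<\infty$;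 $WM_{p,\psi,P}$ is defined likewise with $WL_p$ (weak $L_p$) in place of $L_p$. $\varphi^{1/p}$ denotes the function $\varphi(x,r)^{1/p}$. Bounded means the norm inequality $\|Tf\|\le C\|f\|$ with $C$ independent of $f$. *)

(* Defs.v *)
From HB Require Import structures.
From mathcomp Require Import all_boot all_order all_algebra.
From mathcomp Require Import all_classical all_reals all_analysis.
From mathcomp Require Import measurable_realfun ess_sup_inf.
From mathcomp Require Import complex.

Set Implicit Arguments.
Unset Strict Implicit.
Unset Printing Implicit Defensive.

Import Order.TTheory GRing.Theory Num.Theory.
Import numFieldNormedType.Exports.

Local Open Scope classical_set_scope.
Local Open Scope ring_scope.

(* R^n is 'cV[R]_n with the sigma-algebra generated by the coordinates, that
   is, the Borel sigma-algebra. *)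
Definition cV_display : measure_display. Proof. exact: default_measure_display. Qed.

Section cV_measurable.
Context {R : realType} (n : nat).

Let coors (i : 'I_n) (x : 'cV[R]_n) : R := x i 0.

Let cV_set0 : g_sigma_preimage coors set0.
Proof. exact: sigma_algebra0. Qed.

Let cV_setC A : g_sigma_preimage coors A -> g_sigma_preimage coors (~` A).
Proof. exact: sigma_algebraC. Qed.

Let cV_bigcup (F : _^nat) : (forall i, g_sigma_preimage coors (F i)) ->
  g_sigma_preimage coors (\bigcup_i (F i)).
Proof. exact: sigma_algebra_bigcup. Qed.

HB.instance Definition _ := @isMeasurable.Build cV_display
  'cV[R]_n (g_sigma_preimage coors) cV_set0 cV_setC cV_bigcup.

End cV_measurable.

Definition cV_cons {R : realType} {n : nat} (z : 'cV[R]_n * R) : 'cV[R]_n.+1 :=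
  \col_(i < n.+1) oapp (fun j : 'I_n => z.1 j 0) z.2 (unlift ord0 i).

Lemma measurable_cV_coord {R : realType} {n : nat} (i : 'I_n) :
  measurable_fun [set: 'cV[R]_n] (fun x : 'cV[R]_n => x i 0).
Proof.
move=> _ Y mY; rewrite setTI; apply: sub_sigma_algebra => /=.
rewrite -bigcup_seq/=; exists i => /=; first by rewrite mem_index_enum.
by exists Y => //; rewrite setTI.
Qed.

Lemma measurable_cV_cons {R : realType} {n : nat} :
  measurable_fun setT (@cV_cons R n).
Proof.
move=> _ Y mY; rewrite setTI.
have : (g_sigma_preimage (fun i (x : 'cV[R]_n.+1) => x i 0) : set (set _)) `<=`
    [set A | measurable (@cV_cons R n @^-1` A)].
  apply: smallest_sub.
    split => [|A mA|F mF] /=.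
    - by rewrite preimage_set0.
    - by rewrite setTD -preimage_setC; exact: measurableC.
    - by rewrite preimage_bigcup; exact: bigcupT_measurable.
  rewrite -bigcup_mkord_ord; apply: bigcup_sub => i Ii A [B mB <-] /=.
  rewrite setTI -comp_preimage.
  have mi : measurable_fun setT
      ((fun x : 'cV[R]_n.+1 => x (inord i) 0) \o @cV_cons R n).
    rewrite (_ : _ \o _ = fun z : 'cV[R]_n * R =>
        oapp (fun j : 'I_n => z.1 j 0) z.2 (unlift ord0 (inord i))); last first.
      by apply/funext => z /=; rewrite mxE.
    case: (unlift _ _) => [j|] /=; last exact: measurable_snd.
    apply: (@measurableT_comp _ _ _ _ _ _ (fun x : 'cV[R]_n => x j 0)) => //.
    exact: measurable_cV_coord.
  by rewrite -[X in measurable X]setTI; exact: mi.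
exact.
Qed.

Section lebesgue_cV.
Context {R : realType}.

Section step.
Context (n : nat) (mu : {measure set 'cV[R]_n -> \bar R}).

Definition lebesgue_cV_step : set 'cV[R]_n.+1 -> \bar R :=
  pushforward (mu \x @lebesgue_measure R)%E (@cV_cons R n).

Let step0 : lebesgue_cV_step set0 = 0%E.
Proof. by rewrite /lebesgue_cV_step /pushforward preimage_set0 measure0. Qed.

Let step_ge0 A : (0 <= lebesgue_cV_step A)%E.
Proof. by rewrite /lebesgue_cV_step /pushforward measure_ge0. Qed.

Let step_sigma_additive : semi_sigma_additive lebesgue_cV_step.
Proof.
move=> F mF tF mUF.
have mpre A : measurable A -> measurable (@cV_cons R n @^-1` A).
  by move=> mA; rewrite -[X in measurable X]setTI; exact: measurable_cV_cons.
rewrite /lebesgue_cV_step /pushforward preimage_bigcup.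
apply: measure_semi_sigma_additive.
- by move=> i; exact: mpre.
- apply/trivIsetP => /= i j _ _ ij; rewrite -preimage_setI.
  by move/trivIsetP : tF => /(_ _ _ _ _ ij) ->//; rewrite preimage_set0.
- by rewrite -preimage_bigcup; exact: mpre.
Qed.

HB.instance Definition _ := isMeasure.Build _ _ _ lebesgue_cV_step
  step0 step_ge0 step_sigma_additive.

End step.

(* the n-fold product of the Lebesgue measure of R *)
Fixpoint lebesgue_cV (n : nat) : {measure set 'cV[R]_n -> \bar R} :=
  match n with
  | 0 => \d_ (0 : 'cV[R]_0)
  | m.+1 => lebesgue_cV_step (lebesgue_cV m)
  end.

End lebesgue_cV.

(* Measurability with respect to the completion of mu: the sigma-algebras in
   use are Borel, and a Lebesgue measurable function is one that agrees almost
   everywhere with a Borel function. For such a function the integral of the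
   library is the Lebesgue integral; for a non-Borel set A, on the other hand,
   mu A is meaningless, and the measure of A is the integral of \1_A. *)
Definition completed_measurable_fun {d d'} {T : measurableType d}
    {U : measurableType d'} {R : realType} (mu : {measure set T -> \bar R})
    (D : set T) (f : T -> U) :=
  exists2 g : T -> U, measurable_fun D g & {ae mu, forall x, D x -> f x = g x}.

Section anisotropic.
Context {R : realType} {n : nat}.
Notation V := 'cV[R]_n.
Notation mu := (@lebesgue_cV R n).
Implicit Types (P : 'M[R]_n) (rho : V -> R) (f : V -> \bar R) (D K : set V).

Definition eigenvalues_in_right_half_plane P :=
  forall z : R[i], eigenvalue (map_mx (real_complex R) P) z -> 0 < complex.Re z.

(* t ^ P = exp (ln t P) *)
Definition mxpow (t : R) P : 'M[R]_n :=
  limn (fun N => \sum_(k < N) (ln t ^+ k / k`!%:R) *: P ^+ k).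

(* The last field is the polar decomposition dx = r^(gamma - 1) dsigma(w) dr,
   where r = rho x and w = r^(-P) x, tested against nonnegative functions. That
   rho is measurable is implicit in it; that sigma is finite means that the
   unit ellipsoid has finite volume. *)
Record quasi_distance P rho : Prop := {
  quasi_distance_measurable : measurable_fun setT rho ;
  quasi_distance_homogeneous :
    forall t x, 0 < t -> rho (mxpow t P *m x) = t * rho x ;
  quasi_distance0 : rho 0 = 0 ;
  quasi_distance_ge0 : forall x, 0 <= rho x ;
  quasi_distance_gt0 : forall x, x != 0 -> 0 < rho x ;
  quasi_distanceC : forall x y, rho (x - y) = rho (y - x) ;
  quasi_distance_triangle :
    exists k : R, forall x y z, rho (x - y) <= k * (rho (x - z) + rho (y - z)) ;
  quasi_distance_polar :
    exists2 sigma : {finite_measure set V -> \bar R},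
      sigma (~` [set w | rho w = 1]) = 0%E &
      forall f, measurable_fun setT f -> (forall x, 0 <= f x)%E ->
        (\int[mu]_x f x =
         \int[lebesgue_measure]_(r in `]0%R, +oo[)
           ((r `^ (\tr P - 1))%:E *
            \int[sigma]_(w in [set w | rho w = 1%R]) f (mxpow r P *m w)))%E }.

Definition ellipsoid rho (x : V) (r : R) : set V := [set y | rho (x - y) < r].

Local Open Scope ereal_scope.

(* In the next two definitions gamma stands for \tr P. *)
Definition frac_maximal rho (gamma alpha : R) f (x : V) : \bar R :=
  ereal_sup [set mu (ellipsoid rho x t) `^ (- 1 + alpha / gamma)%R *
                 \int[mu]_(y in ellipsoid rho x t) `|f y| | t in `]0%R, +oo[].

(* Where the integral does not converge absolutely its value is infinite, as
   +oo - +oo = -oo. *)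
Definition riesz_potential rho (gamma alpha : R) f (x : V) : \bar R :=
  \int[mu]_y (f y * (rho (x - y) `^ (gamma - alpha))^-1%:E).

Definition Lp_norm (p : R) D f : \bar R := 'N[mu]_p%:E[f \_ D].

Definition superlevel f (t : R) : set V := [set x | t%:E < `|f x|].

Definition WLp_norm (p : R) D f : \bar R :=
  ereal_sup [set t%:E *
    (\int[mu]_(y in D) (\1_(superlevel f t) y)%:E) `^ p^-1%R
      | t in `]0%R, +oo[].

Definition morrey_norm rho (N : set V -> (V -> \bar R) -> \bar R) (p : R)
    (psi : V -> R -> R) f : \bar R :=
  ereal_sup [set (psi z.1 z.2)^-1%:E *
                 mu (ellipsoid rho z.1 z.2) `^ (- p^-1)%R *
                 N (ellipsoid rho z.1 z.2) f
               | z in setT `*` `]0%R, +oo[].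

Definition morrey rho (N : set V -> (V -> \bar R) -> \bar R) (p : R)
    (psi : V -> R -> R) : set (V -> \bar R) :=
  [set f | [/\ completed_measurable_fun mu setT f,
               forall K, compact K -> N K f < +oo &
               morrey_norm rho N p psi f < +oo]].

(* M_{p,psi,P} and WM_{p,psi,P} *)
Definition M_norm rho p := morrey_norm rho (Lp_norm p) p.
Definition M_space rho p := morrey rho (Lp_norm p) p.
Definition WM_norm rho p := morrey_norm rho (WLp_norm p) p.
Definition WM_space rho p := morrey rho (WLp_norm p) p.

Definition bounded_operator (T : (V -> \bar R) -> (V -> \bar R))
    (X : set (V -> \bar R)) (normX : (V -> \bar R) -> \bar R)
    (Y : set (V -> \bar R)) (normY : (V -> \bar R) -> \bar R) :=
  exists C : R, forall f, X f -> Y (T f) /\ normY (T f) <= C%:E * normX f.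

End anisotropic.

(* Main.v *)
Require Import Defs.
From HB Require Import structures.
From mathcomp Require Import all_boot all_order all_algebra.
From mathcomp Require Import all_classical all_reals all_analysis.
From mathcomp Require Import measurable_realfun ess_sup_inf.
From mathcomp Require Import ring lra.

Import Order.TTheory GRing.Theory Num.Theory.
Import numFieldNormedType.Exports.

Local Open Scope classical_set_scope.
Local Open Scope ring_scope.

Set Implicit Arguments.
Unset Strict Implicit.
Unset Printing Implicit Defensive.

(* The ellipsoids are the balls of the quasi-metric rho (x - y), and by the
   polar decomposition and translation invariance they have measure v r^gamma.
   In such a space the Hardy-Littlewood maximal function M is of weak type (1,1)
   and strong type (p,p); splitting f into its parts inside and outside
   E(x, 2kr), the first condition on phi makes M bounded on M_{p,phi^{1/p}}.
   Writing rho^{alpha-gamma} as an integral of t^{alpha-gamma-1} over t > rho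
   gives
     I_alpha |f| (x) = (gamma-alpha) int_0^oo t^{alpha-gamma-1} int_{E(x,t)} |f| dt.
   Bounding the inner integral by t^gamma M f (x) for t <= r, and by Hoelder's
   inequality and the second condition on phi for t > r, yields
     I_alpha |f| (x) <= A (r^alpha M f (x) + r^{-alpha p/(q-p)} ||f||)
   for all r > 0. The best r gives Hedberg's pointwise inequality
     I_alpha |f| <= 2 A (M f)^{p/q} ||f||^{1-p/q},
   which transfers the bounds for M to I_alpha, and M_alpha f is at most a
   constant times I_alpha |f|. *)

(** * Integrals of powers and layer cakes *)

(** The exponent of the second condition is what closes the argument. At the best radius both terms
    of the split equal m^{p/q}, where m = M f (x), and (m^{p/q})^q = m^p. Hence the L_q norm of the
    potential over an ellipsoid is controlled by the L_p norm of M f over the same ellipsoid, and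
    both estimates carry the same factor phi(x,r) |E(x,r)|. This is why the target weight is
    phi^{1/q}. The factor ||f||^{1-p/q} never appears explicitly: f is divided by a positive number
    N above its norm, and N is restored by homogeneity. Two obstacles shape the work. Since [rho] is
    not assumed continuous, covering arguments cannot use open sets or compactness; they restrict
    the radii to finite lists and leave the centres free. And f is measurable only up to a null set,
    while phi(x,.) is not known to be measurable for a fixed x. Comparisons therefore use the
    integral of a nonnegative function as a supremum over simple functions, which is monotone
    without any measurability. *)

Section power_integrals.
Context {R : realType}.
Notation leb := (@lebesgue_measure R).
Local Open Scope ereal_scope.

Lemma continuous_powR_pos (a x : R) : (0 < x)%R ->
  {for x, continuous (fun t : R => t `^ a)%R}.
Proof.
move=> x0; apply/differentiable_continuous/derivable1_diffP.
by apply: derivable_powR; rewrite in_itv/= x0.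
Qed.

Lemma derive1_powR_scaled (a c x : R) : (0 < x)%R ->
  ((fun t : R => c * t `^ a)%R^`())%classic x = (c * (a * x `^ (a - 1)))%R.
Proof.
move=> x0; have H := is_derive1_powR a x0.
rewrite derive1E (_ : (fun t : R => _) = (c \*: (fun t : R => t `^ a))%R)//.
rewrite deriveZ; last by apply: derivable_powR; rewrite in_itv/= x0.
by congr (_ * _)%R; rewrite derive_val.
Qed.

Lemma integral_powR_tail (b x : R) : (0 < b)%R -> (0 < x)%R ->
  \int[leb]_(t in `[x, +oo[) (b * t `^ (- b - 1))%:E = (x `^ (- b))%:E.
Proof.
move=> b0 x0.
rewrite (@ge0_continuous_FTC2y _ _ (fun t => (-1) * t `^ (- b))%R x 0%R).
- by rewrite sub0e -EFinN mulN1r opprK.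
- by move=> t xt; rewrite mulr_ge0 ?powR_ge0// ltW.
- apply: continuous_in_subspaceT => t; rewrite inE/= in_itv/= andbT => xt.
  apply: cvgM; first exact: cvg_cst.
  by apply: continuous_powR_pos; exact: lt_le_trans xt.
- rewrite -[X in _ --> X](mulr0 (-1)%R); apply: cvgM; first exact: cvg_cst.
  apply/cvgrPdist_le => e e0; near=> t.
  have t0 : (0 < t)%R by near: t; exact: nbhs_pinfty_gt.
  rewrite sub0r normrN ger0_norm ?powR_ge0// powRN.
  rewrite -[leRHS]invrK lef_pV2 ?posrE ?powR_gt0 ?invr_gt0//.
  (* Writing 1/e as ((1/e)^{1/b})^b exhibits (1/e)^{1/b} as the threshold for t. *)
  rewrite -[leLHS]powRr1 ?invr_ge0 ?ltW// -(mulVf (lt0r_neq0 b0)) powRrM.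
  apply: (gt0_ltr_powR b0); rewrite ?nnegrE ?powR_ge0 ?ltW// ?ltW//.
- move=> t xt; rewrite (_ : (fun t : R => _) = ((-1) \*: (fun t : R => t `^ (- b)))%R)//.
  apply: derivableZ; apply: derivable_powR.
  by rewrite in_itv/= andbT (lt_trans x0).
- apply: cvg_at_right_filter; apply: cvgM; first exact: cvg_cst.
  exact: continuous_powR_pos.
- move=> t; rewrite in_itv/= andbT => xt.
  by rewrite derive1_powR_scaled ?(lt_trans x0)// mulrA mulrNN mul1r.
Unshelve. all: by end_near. Qed.

(** For a < 1 the integrand is unbounded at 0, so the fundamental theorem is applied on [x/(m+2), x]
    and m tends to infinity by monotone convergence. The shift by 2 keeps the left end strictly
    below x already for m = 0. *)
Lemma integral_powR_head (a x : R) : (0 < a)%R -> (0 < x)%R ->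
  \int[leb]_(t in `]0%R, x[) (a * t `^ (a - 1))%:E = (x `^ a)%:E.
Proof.
move=> a0 x0.
have mf : measurable_fun setT (fun t : R => (a * t `^ (a - 1))%:E).
  by apply/measurable_EFinP; apply: measurable_funM => //; exact: measurable_powR.
rewrite integral_itv_bndo_bndc; last exact: measurable_funTS.
pose c (m : nat) : R := (x / m.+2%:R)%R.
have c0 m : (0 < c m)%R by rewrite divr_gt0.
have cx m : (c m < x)%R by rewrite ltr_pdivrMr// ltr_pMr// ltr1n.
have c_to0 : c m @[m --> \oo] --> (0 : R)%R.
  rewrite -[X in _ --> X](mulr0 x); apply: cvgM; first exact: cvg_cst.
  rewrite (_ : (fun m => _) = (fun m => harmonic m.+1)%R)//.
  by rewrite (cvg_shiftS (@harmonic R : nat -> R^o)); exact: cvg_harmonic.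
have -> : `]0%R, x]%classic = \bigcup_m `[c m, x]%classic.
  apply/seteqP; split => [t/=|t [m _]/=]; rewrite !in_itv/=; last first.
    by case/andP => ct ->; rewrite (lt_le_trans (c0 m)).
  case/andP=> t0 tx.
  have /cvgrPdist_lt/(_ _ t0)[m _ /(_ m (leqnn m))] := c_to0.
  rewrite /= sub0r normrN gtr0_norm// => cmt.
  by exists m => //=; rewrite in_itv/= tx ltW.
have Hn m : \int[leb]_(t in `[c m, x]) (a * t `^ (a - 1))%:E =
    (x `^ a - c m `^ a)%:E.
  rewrite (@continuous_FTC2 _ _ (fun t => t `^ a)%R)//.
  - apply: continuous_in_subspaceT => t; rewrite inE/= in_itv/= => /andP[ct _].
    apply: cvgM; first exact: cvg_cst.
    by apply: continuous_powR_pos; exact: lt_le_trans ct.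
  - split.
    + move=> t; rewrite in_itv/= => /andP[ct _]; apply: derivable_powR.
      by rewrite in_itv/= (lt_trans (c0 m)).
    + by apply: cvg_at_right_filter; exact: continuous_powR_pos.
    + by apply: cvg_at_left_filter; exact: continuous_powR_pos.
  - move=> t; rewrite in_itv/= => /andP[ct _].
    by rewrite powR_derive1// in_itv/= (lt_trans (c0 m)).
have H1 : (fun m => \int[leb]_(t in `[c m, x]) (a * t `^ (a - 1))%:E) @ \oo -->
    \int[leb]_(t in \bigcup_m `[c m, x]%classic) (a * t `^ (a - 1))%:E.
  apply: ge0_nondecreasing_set_cvg_integral => //.
  - move=> m m' mm'; apply/subsetPset => t/=; rewrite !in_itv/= => /andP[ct ->].
    rewrite andbT (le_trans _ ct)// ler_pM2l// lef_pV2 ?posrE//.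
    by rewrite ler_nat.
  - by move=> m; exact: measurable_funTS.
  - by move=> m t _; rewrite lee_fin mulr_ge0 ?powR_ge0// ltW.
suff H2 : (fun m => (x `^ a - c m `^ a)%:E) @ \oo --> (x `^ a)%:E.
  have /funext Hn' := Hn; rewrite Hn' in H1.
  exact: (cvg_unique _ H1 H2).
apply: cvg_EFin; first by near=> m.
rewrite -[X in _ --> X]subr0; apply: cvgB; first exact: cvg_cst.
by have /cvg_at_rightP := powR_cvg0 a0; apply; split.
Unshelve. all: by end_near. Qed.

End power_integrals.

Section integral_without_measurability.
Context d (T : measurableType d) (R : realType) (mu : {measure set T -> \bar R}).
Local Open Scope ereal_scope.
Implicit Types (f g : T -> \bar R) (D : set T).

Import HBNNSimple.

(* The integral of a nonnegative function is the supremum of the integrals of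
   the simple functions below it, so no measurability is involved. *)
Lemma ge0_le_lower_integral D f g : (forall x, D x -> 0 <= f x) ->
  (forall x, D x -> f x <= g x) ->
  \int[mu]_(x in D) f x <= \int[mu]_(x in D) g x.
Proof.
move=> f0 fg; rewrite !ge0_integralE//; last first.
  by move=> x Dx; rewrite (le_trans (f0 _ Dx))// fg.
apply: ge_ereal_sup => _ [h hf <-]; apply: ereal_sup_ubound; exists h => // x.
apply: (le_trans (hf x)); rewrite /patch; case: ifPn => // /set_mem; exact: fg.
Qed.

(** Only a simple function below f has to avoid the null set: being measurable, it loses no integral
    when restricted to the complement of [N], where it lies below g. *)
Lemma ae_ge0_le_lower_integral D f g :
  (forall x, D x -> 0 <= f x) -> (forall x, D x -> 0 <= g x) ->
  {ae mu, forall x, D x -> f x <= g x} ->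
  \int[mu]_(x in D) f x <= \int[mu]_(x in D) g x.
Proof.
move=> f0 g0 [N [mN N0 fgN]].
rewrite [leLHS]ge0_integralE//; apply: ge_ereal_sup => _ [h hf <-].
rewrite -integralT_nnsfun (@ge0_negligible_integral _ _ _ _ _ N)//; last 2 first.
- exact/measurable_EFinP.
- by move=> x _; rewrite lee_fin.
rewrite (integral_mkcond (setT `\` N)) (integral_mkcond D).
apply: ge0_le_lower_integral => x _.
  by rewrite erestrict_ge0// => y _; rewrite lee_fin.
rewrite /patch; case: ifPn => [|_]; last by case: ifPn => // /set_mem; exact: g0.
rewrite in_setD in_setT/= => /negP xN; have := hf x; rewrite /patch.
case: ifPn => // /set_mem Dx hx; apply: (le_trans hx); apply: contrapT => fgx.
by apply: xN; apply/mem_set/fgN => /= /(_ Dx).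
Qed.

Lemma ae_eq_lower_integral D f g : {ae mu, forall x, D x -> f x = g x} ->
  \int[mu]_(x in D) f x = \int[mu]_(x in D) g x.
Proof.
move=> fg; rewrite integralE [RHS]integralE.
by congr (_ - _); apply/eqP; rewrite eq_le; apply/andP; split;
   apply: ae_ge0_le_lower_integral => //; apply: filterS fg => x fgx Dx;
   rewrite ?funepos.unlock ?funeneg.unlock fgx.
Qed.

End integral_without_measurability.

Section tonelli_weight.
Context d1 d2 (T1 : measurableType d1) (T2 : measurableType d2) (R : realType).
Context (m1 : {sigma_finite_measure set T1 -> \bar R}).
Context (m2 : {sigma_finite_measure set T2 -> \bar R}).
Local Open Scope ereal_scope.

(** Both sides are iterated integrals of u(x) w(t) 1_S(x,t). Both layer cakes are instances, with S
    the region below or above a graph. *)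
Lemma tonelli_weight (u : T1 -> \bar R) (w : T2 -> \bar R) (S : set (T1 * T2)) :
  measurable_fun setT u -> (forall x, 0 <= u x) ->
  measurable_fun setT w -> (forall t, 0 <= w t) -> measurable S ->
  \int[m1]_x (u x * \int[m2]_(t in [set t | S (x, t)]) w t) =
  \int[m2]_t (w t * \int[m1]_(x in [set x | S (x, t)]) u x).
Proof.
move=> mu u0 mw w0 mS.
have mSx x : measurable [set t | S (x, t)].
  by have := measurable_xsection x mS; rewrite xsectionE.
have mSt t : measurable [set x | S (x, t)].
  by have := measurable_ysection t mS; rewrite ysectionE.
pose K (z : T1 * T2) := u z.1 * (w z.2 * (\1_S z)%:E).
have mK : measurable_fun setT K.
  apply: emeasurable_funM; first exact: measurableT_comp.
  apply: emeasurable_funM; first exact: measurableT_comp.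
  exact/measurable_EFinP.
have K0 z : 0 <= K z by rewrite mule_ge0// mule_ge0// lee_fin.
have mwS x : measurable_fun setT (w \_ [set t | S (x, t)]).
  exact: (measurable_restrictT _ (mSx x)).1 (measurable_funTS mw).
have muS t : measurable_fun setT (u \_ [set x | S (x, t)]).
  exact: (measurable_restrictT _ (mSt t)).1 (measurable_funTS mu).
transitivity (\int[m1]_x \int[m2]_t K (x, t)).
  apply: eq_integral => x _; rewrite integral_mkcond.
  rewrite -(ge0_integralZl _ measurableT (mwS x))//; last first.
    by move=> t _; rewrite erestrict_ge0.
  apply: eq_integral => t _; rewrite epatch_indic/= /K/= !indicE.
  by rewrite (_ : (t \in _) = ((x, t) \in S))//; apply/idP/idP => /set_mem/mem_set.
rewrite (fubini_tonelli _ mK K0); apply: eq_integral => t _.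
rewrite [in RHS]integral_mkcond -(ge0_integralZl _ measurableT (muS t))//; last first.
  by move=> x _; rewrite erestrict_ge0.
apply: eq_integral => x _; rewrite epatch_indic/= /K/= !indicE muleCA.
by rewrite (_ : (x \in _) = ((x, t) \in S))//; apply/idP/idP => /set_mem/mem_set.
Qed.

End tonelli_weight.

Section layer_cake.
Context d (T : measurableType d) (R : realType).
Context (mu : {sigma_finite_measure set T -> \bar R}).
Notation leb := (@lebesgue_measure R).
Local Open Scope ereal_scope.

Lemma measurable_powR_density (a b : R) :
  measurable_fun setT (fun t : measurableTypeR R => (a * t `^ b)%:E).
Proof.
by apply/measurable_EFinP; apply: measurable_funM => //; exact: measurable_powR.
Qed.

Lemma integral_powR_layer (a : R) (x : \bar R) : (0 < a)%R -> 0 <= x ->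
  \int[leb]_(t in [set t : measurableTypeR R | (0 < t)%R /\ t%:E < x])
    (a * t `^ (a - 1))%:E = x `^ a.
Proof.
move=> a0; case: x => [x| |//].
- rewrite lee_fin le_eqVlt => /predU1P[<-|x0].
    rewrite poweR0r ?gt_eqF// (_ : [set t | _] = set0) ?integral_set0//.
    by apply/seteqP; split => t //= -[t0]; rewrite lte_fin ltNge ltW.
  rewrite poweR_EFin -integral_powR_head// (_ : [set t | _] = `]0%R, x[%classic)//.
  by apply/seteqP; split => t /=; rewrite in_itv/= lte_fin => /andP.
- move=> _; rewrite poweRyr ?gt_eqF//; apply/eqyP => y y0.
  set D := [set t | _].
  have mf D' : measurable_fun D' (fun t : measurableTypeR R => (a * t `^ (a - 1))%:E).
    by apply: measurable_funTS; exact: measurable_powR_density.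
  (* Every finite y is the integral over the bounded interval ]0, y^{1/a}[, so the integral over the
     half-line exceeds every finite number. *)
  have -> : y%:E = ((y `^ a^-1) `^ a)%:E.
    by rewrite -powRrM mulVf ?gt_eqF// powRr1// ltW.
  rewrite -integral_powR_head ?powR_gt0//.
  have DE : D = `]0%R, +oo[%classic.
    apply/seteqP; split => t /=; rewrite in_itv/= ?andbT; first by case.
    by move=> t0; split => //; rewrite ltry.
  rewrite DE; apply: ge0_subset_integral => //.
    by move=> t _; rewrite lee_fin mulr_ge0 ?powR_ge0// ltW.
  by move=> t /=; rewrite !in_itv/= andbT => /andP[].
Qed.

(** The weight u lets one formula serve twice in the interpolation argument: with u = 1 for the
    maximal function and with u a multiple of h for the function itself. *)
Lemma layer_cake (a : R) (u g : T -> \bar R) : (0 < a)%R ->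
  measurable_fun setT u -> (forall x, 0 <= u x) ->
  measurable_fun setT g -> (forall x, 0 <= g x) ->
  \int[mu]_x (u x * g x `^ a) =
  \int[leb]_(t in `]0%R, +oo[)
    ((a * t `^ (a - 1))%:E * \int[mu]_(x in [set x | t%:E < g x]) u x).
Proof.
move=> a0 mu_u u0 mg g0.
pose S := [set z : T * measurableTypeR R | (0 < z.2)%R /\ z.2%:E < g z.1].
have mS : measurable S.
  rewrite (_ : S = (setT `&` [set z | 0%:E < z.2%:E]) `&`
      (setT `&` [set z | z.2%:E < g z.1])); last by rewrite !setTI.
  have mE : measurable_fun setT (fun z : T * measurableTypeR R => z.2%:E).
    by apply/measurable_EFinP; exact: measurable_snd.
  apply: measurableI; apply: measurable_lte => //.
  exact: measurableT_comp.
transitivity (\int[mu]_x (u x * \int[leb]_(t in [set t | S (x, t)])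
    (a * t `^ (a - 1))%:E)).
  by apply: eq_integral => x _; rewrite -integral_powR_layer.
rewrite (tonelli_weight _ _ mu_u u0 (measurable_powR_density _ _) _ mS); last first.
  by move=> t; rewrite lee_fin mulr_ge0 ?powR_ge0// ltW.
rewrite [RHS]integral_mkcond; apply: eq_integral => t _.
rewrite patchE mem_setE in_itv/= andbT /S; case: ifPn => [t0|/negP t0].
  by congr (_ * integral _ _ _); apply/seteqP; split => x /=; [case|].
rewrite (_ : [set x | _] = set0) ?integral_set0 ?mule0//.
by apply/seteqP; split => x //= -[].
Qed.

(** Since x^{-b} is the integral of b t^{-b-1} over t > x, this turns a negative power of the
    distance into masses of balls. It is only an inequality: where g x = 0 the inverse on the left
    is 0 by convention, whereas the integral of the weight diverges. *)
Lemma layer_cake_tail (b : R) (u : T -> \bar R) (g : T -> R) : (0 < b)%R ->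
  measurable_fun setT u -> (forall x, 0 <= u x) ->
  measurable_fun setT g -> (forall x, (0 <= g x)%R) ->
  \int[mu]_x (u x * (g x `^ b)^-1%:E) <=
  \int[leb]_(t in `]0%R, +oo[)
    ((b * t `^ (- b - 1))%:E * \int[mu]_(x in [set x | (g x < t)%R]) u x).
Proof.
move=> b0 mu_u u0 mg g0.
pose S := [set z : T * measurableTypeR R | (g z.1 < z.2)%R].
have mS : measurable S.
  rewrite (_ : S = (setT `&` [set z | (g z.1)%:E < z.2%:E])); last first.
    by rewrite setTI; apply/seteqP; split => z /=; rewrite lte_fin.
  apply: measurable_lte => //; apply/measurable_EFinP; last exact: measurable_snd.
  exact: measurableT_comp.
have w0 (t : measurableTypeR R) : 0 <= (b * t `^ (- b - 1))%:E.
  by rewrite lee_fin mulr_ge0 ?powR_ge0// ltW.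
apply: (@le_trans _ _ (\int[mu]_x (u x * \int[leb]_(t in [set t | S (x, t)])
    (b * t `^ (- b - 1))%:E))).
  apply: ge0_le_lower_integral => x _.
    by rewrite mule_ge0// lee_fin invr_ge0 powR_ge0.
  apply: lee_pmul => //; first by rewrite lee_fin invr_ge0 powR_ge0.
  have := g0 x; rewrite le_eqVlt => /predU1P[<-|gx0].
    by rewrite powR0 ?gt_eqF// invr0 integral_ge0.
  rewrite -powRN -integral_powR_tail// -integral_itv_obnd_cbnd; last first.
    by apply: measurable_funTS; exact: measurable_powR_density.
  rewrite (_ : [set t | _] = `]g x, +oo[%classic)//.
  by apply/seteqP; split => t /=; rewrite in_itv/= andbT.
rewrite (tonelli_weight _ _ mu_u u0 (measurable_powR_density _ _) _ mS)//.
rewrite [leRHS]integral_mkcond; apply: ge0_le_lower_integral => t _.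
  by rewrite mule_ge0// integral_ge0.
rewrite patchE mem_setE in_itv/= andbT /S; case: ifPn => [//|/negP t0].
rewrite (_ : [set x | _] = set0) ?integral_set0 ?mule0//.
by apply/seteqP; split => x //= gxt; apply: t0; exact: le_lt_trans gxt.
Qed.

End layer_cake.

(** * Maximal functions on Ahlfors regular quasi-metric spaces *)

(* To be used with delta x y = rho (x - y) and g = tr P. *)
Record regular_quasimetric {d} {T : measurableType d} {R : realType}
    (mu : set T -> \bar R) (delta : T -> T -> R) (k v g : R) : Prop := {
  rq_measurable : measurable_fun setT (fun z : T * T => delta z.1 z.2) ;
  rq_ge0 : forall x y, 0 <= delta x y ;
  rq_sym : forall x y, delta x y = delta y x ;
  rq_triangle : forall x y z, delta x y <= k * (delta x z + delta y z) ;
  rq_k_ge1 : 1 <= k ;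
  rq_v_gt0 : 0 < v ;
  rq_g_gt0 : 0 < g ;
  rq_ball : forall x r, 0 < r ->
    mu [set y | delta x y < r] = (v * r `^ g)%:E }.

Section maximal_function.
Context d (T : measurableType d) (R : realType).
Context (mu : {sigma_finite_measure set T -> \bar R}).
Context (delta : T -> T -> R) (k v g : R).
Context (Q : regular_quasimetric mu delta k v g).
Local Open Scope ereal_scope.
Implicit Types (h : T -> \bar R) (x y : T) (r s t : R).

Definition ball_mass h x r := \int[mu]_(y in [set y | (delta x y < r)%R]) h y.

Lemma measurable_rq_ball x r : measurable [set y | (delta x y < r)%R].
Proof.
rewrite -[X in measurable X]setTI.
have m1 : measurable_fun setT (fun y => (delta x y)).
  exact: (measurable_fun_pair2 x (rq_measurable Q)).
by have := m1 measurableT _ (measurable_itv `]-oo, r[);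
  rewrite preimage_itvNyo; apply.
Qed.
Hint Resolve measurable_rq_ball : core.

Lemma ball_mass_ge0 h x r : (forall y, 0 <= h y) -> 0 <= ball_mass h x r.
Proof. by move=> h0; exact: integral_ge0. Qed.

Lemma measurable_ball_mass h r : measurable_fun setT h -> (forall y, 0 <= h y) ->
  measurable_fun setT (ball_mass h ^~ r).
Proof.
move=> mh h0.
pose f (z : T * T) := h z.2 * (\1_[set z : T * T | (delta z.1 z.2 < r)%R] z)%:E.
have mf : measurable_fun setT f.
  apply: emeasurable_funM; first exact: measurableT_comp.
  apply/measurable_EFinP/measurable_indic.
  rewrite -[X in measurable X]setTI.
  by have := rq_measurable Q measurableT (measurable_itv `]-oo, r[);
    rewrite preimage_itvNyo; apply.
have f0 z : 0 <= f z by rewrite mule_ge0// lee_fin.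
have := measurable_fun_fubini_tonelli_F (m2 := mu) _ mf f0.
apply: eq_measurable_fun => x _; rewrite /fubini_F /ball_mass [RHS]integral_mkcond.
apply: eq_integral => y _; rewrite epatch_indic /f/= !indicE.
by congr (_ * (_)%:R%:E); apply/idP/idP => /set_mem/mem_set.
Qed.

Lemma ball_mass_mono h x r s : measurable_fun setT h -> (forall y, 0 <= h y) ->
  (r <= s)%R -> ball_mass h x r <= ball_mass h x s.
Proof.
move=> mh h0 rs; apply: ge0_subset_integral => //; first exact: measurable_funTS.
by move=> y /= xy; exact: lt_le_trans xy rs.
Qed.

(** Balls are defined by a strict inequality, so the mass is left-continuous in the radius: the
    balls of radius r - r/(m+2) increase to the ball of radius r. *)
Lemma ball_mass_rat h x r (l : \bar R) : measurable_fun setT h -> (forall y, 0 <= h y) ->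
  (0 < r)%R -> l < ball_mass h x r ->
  exists2 q : rat, (0 < (ratr q : R) < r)%R & l < ball_mass h x (ratr q).
Proof.
move=> mh h0 r0 lF; apply: contrapT => noq; move: lF; apply/negP; rewrite -leNgt.
pose c (m : nat) : R := (r - r / m.+2%:R)%R.
have cr m : (c m < r)%R by rewrite /c ltrBlDr ltrDl divr_gt0.
have c0 m : (0 < c m)%R by rewrite /c subr_gt0 ltr_pdivrMr// ltr_pMr// ltr1n.
have ndc : nondecreasing_seq c.
  by move=> m m' mm'; rewrite lerB// ler_pM2l// lef_pV2 ?posrE// ler_nat.
have cvF : (fun m => ball_mass h x (c m)) @ \oo --> ball_mass h x r.
  rewrite /ball_mass.
  have -> : [set y | (delta x y < r)%R] = \bigcup_m [set y | (delta x y < c m)%R].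
    apply/seteqP; split => [y/= xyr|y [m _] /= xym]; last exact: lt_trans (cr m).
    have r1 : (0 < 1 - delta x y / r)%R by rewrite subr_gt0 ltr_pdivrMr// mul1r.
    have /cvgrPdist_lt/(_ _ r1)[m _ /(_ m (leqnn m))] := @cvg_harmonic R.
    rewrite /= sub0r normrN gtr0_norm// => mr.
    exists m => //=; rewrite /c ltrBrDr -ltrBrDl.
    have : (r * (m.+1%:R)^-1 < r * (1 - delta x y / r))%R by rewrite ltr_pM2l.
    rewrite mulrBr mulr1 [X in (_ < _ - X)%R]mulrC divfK ?gt_eqF//.
    by apply: le_lt_trans; rewrite ler_pM2l// lef_pV2 ?posrE// ler_nat.
  apply: ge0_nondecreasing_set_cvg_integral => //.
  - by move=> m m' /ndc cmm'; apply/subsetPset => y /=; move=> /lt_le_trans; apply.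
  - by move=> m; exact: measurable_funTS.
have Fl m : ball_mass h x (c m) <= l.
  have [q] := rat_in_itvoo (cr m); rewrite in_itv/= => /andP[cq qr].
  apply: (le_trans (ball_mass_mono x mh h0 (ltW cq))); rewrite leNgt; apply/negP => lq.
  by apply: noq; exists q => //; rewrite qr (lt_trans (c0 m)).
have := @ereal_nondecreasing_cvgn _ (fun m => ball_mass h x (c m)).
move=> /(_ (fun m m' mm' => ball_mass_mono x mh h0 (ndc _ _ mm'))) cvF'.
rewrite (cvg_unique _ cvF cvF')//; apply: ge_ereal_sup => _ [m _ <-]; exact: Fl.
Qed.

(* The exponents of interest are s = g (Hardy-Littlewood) and s = g - alpha
   (fractional). *)
Definition maximal (s : R) h x : \bar R :=
  ereal_sup [set (t `^ (- s))%:E * ball_mass h x t | t in `]0%R, +oo[].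

(** Makes superlevel sets countable unions over rational radii. A rational q slightly below t works
    because the mass is left-continuous and c t^s does not increase when t is lowered, as s >= 0. *)
Lemma maximal_gtP s h x (c : R) : (0 <= s)%R ->
  measurable_fun setT h -> (forall y, 0 <= h y) -> (0 <= c)%R ->
  c%:E < maximal s h x <-> exists2 q : rat, (0 < ratr q :> R)%R &
    (c * ratr q `^ s)%:E < ball_mass h x (ratr q).
Proof.
move=> s0 mh h0 c0; have key t : (0 < t)%R ->
    (c%:E < (t `^ (- s))%:E * ball_mass h x t) = ((c * t `^ s)%:E < ball_mass h x t).
  by move=> t0; rewrite powRN lte_pdivlMl ?powR_gt0// EFinM muleC.
split=> [|[q q0 qF]].
  case/ereal_sup_gt => z [t]; rewrite /= in_itv/= andbT => t0 <-{z}; rewrite key// => tF.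
  have [q /andP[q0 qt] qF] := ball_mass_rat mh h0 t0 tF; exists q => //.
  apply: le_lt_trans qF; rewrite lee_fin ler_wpM2l//.
  by apply: ge0_ler_powR; rewrite ?nnegrE// ltW.
apply: (@lt_le_trans _ _ ((ratr q `^ (- s))%:E * ball_mass h x (ratr q))).
  by rewrite key.
by apply: ereal_sup_ubound; exists (ratr q) => //; rewrite /= in_itv/= q0.
Qed.

Lemma maximal_ge0 s h x : (forall y, 0 <= h y) -> 0 <= maximal s h x.
Proof.
move=> h0; apply: le_ereal_sup_tmp; exists ((1 `^ (- s))%:E * ball_mass h x 1).
  by exists 1%R => //; rewrite /= in_itv/= ltr01.
by rewrite mule_ge0 ?lee_fin ?powR_ge0// ball_mass_ge0.
Qed.

Lemma measurable_maximal s h : (0 <= s)%R ->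
  measurable_fun setT h -> (forall y, 0 <= h y) -> measurable_fun setT (maximal s h).
Proof.
move=> s0 mh h0; apply: (measurability _ (ErealGenOInfty.measurableE R)).
move=> /= A [E [c ->] <-{A}]; rewrite setTI.
have [c0|c0] := leP 0%R c; last first.
  rewrite (_ : _ @^-1` _ = setT)//; apply/seteqP; split => x //= _.
  by rewrite in_itv/= andbT (lt_le_trans _ (maximal_ge0 s x h0))// lte_fin.
rewrite (_ : _ @^-1` _ = \bigcup_q [set x | (0 < (ratr q : R))%R /\
   (c * ratr q `^ s)%:E < ball_mass h x (ratr q)]); last first.
  apply/seteqP; split => [x|x [q _ [q0 qF]]] /=; rewrite in_itv/= andbT.
    by move=> /(maximal_gtP _ s0 mh h0 c0)[q q0 qF]; exists q.
  by apply/(maximal_gtP _ s0 mh h0 c0); exists q.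
apply: bigcupT_measurable_rat => q.
have [q0|q0] := ltP 0%R (ratr q : R); last first.
  rewrite (_ : [set _ | _] = set0)//; by apply/seteqP; split => x //= -[].
rewrite (_ : [set _ | _] = setT `&` [set x | (c * ratr q `^ s)%:E < ball_mass h x (ratr q)]).
  by apply: emeasurable_fun_o_infty => //; exact: measurable_ball_mass.
by apply/seteqP; split => x /= [].
Qed.

Lemma measurable_ball_mass_radius h x : measurable_fun setT h -> (forall y, 0 <= h y) ->
  measurable_fun setT (fun t : measurableTypeR R => ball_mass h x t).
Proof.
move=> mh h0.
pose S := [set z : T * measurableTypeR R | (delta x z.1 < z.2)%R].
have mS : measurable S.
  rewrite (_ : S = (setT `&` [set z | (delta x z.1)%:E < z.2%:E])); last first.
    by rewrite setTI; apply/seteqP; split => z /=; rewrite lte_fin.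
  apply: measurable_lte => //; apply/measurable_EFinP; last exact: measurable_snd.
  apply: (@measurableT_comp _ _ _ _ _ _ (delta x)) => //.
  exact: (measurable_fun_pair2 x (rq_measurable Q)).
pose f (z : T * measurableTypeR R) := h z.1 * (\1_S z)%:E.
have mf : measurable_fun setT f.
  by apply: emeasurable_funM; [exact: measurableT_comp|exact/measurable_EFinP].
have f0 z : 0 <= f z by rewrite mule_ge0// lee_fin.
have := measurable_fun_fubini_tonelli_G (m1 := mu) _ mf f0.
apply: eq_measurable_fun => t _; rewrite /fubini_G /ball_mass [RHS]integral_mkcond.
apply: eq_integral => y _; rewrite epatch_indic /f/= !indicE.
by congr (_ * (_)%:R%:E); apply/idP/idP => /set_mem/mem_set.
Qed.

End maximal_function.

(** * The weak type (1,1) inequality by a greedy covering *)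

Section weak_type.
Context d (T : measurableType d) (R : realType).
Context (mu : {sigma_finite_measure set T -> \bar R}).
Context (delta : T -> T -> R) (k v g : R).
Context (Q : regular_quasimetric mu delta k v g).
Context (h : T -> \bar R) (mh : measurable_fun setT h) (h0 : forall y, (0 <= h y)%E).
Context (l : R) (l0 : 0 < l).
Local Open Scope ereal_scope.

Let B x r := [set y | (delta x y < r)%R].
Let heavy x r := (l * r `^ g)%:E < ball_mass mu delta h x r.
Let I := \int[mu]_y h y.

Record selection (rs : seq R) (n : nat) (X : nat -> T) (S : nat -> R) : Prop := {
  sel_in : forall i, (i < n)%N -> S i \in rs ;
  sel_heavy : forall i, (i < n)%N -> heavy (X i) (S i) ;
  sel_disj : trivIset `I_n (fun i => B (X i) (S i)) }.

(** Disjoint balls have total mass at most [I]. This both bounds the number of balls that can be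
    selected and controls the measure of their dilates. *)
Lemma selection_sum rs n X S : (forall r, r \in rs -> (0 < r)%R) ->
  selection rs n X S -> (\sum_(i < n) l * S i `^ g)%:E <= I.
Proof.
move=> rs0 sel.
apply: (@le_trans _ _ (\sum_(i < n) ball_mass mu delta h (X i) (S i))).
  rewrite -sumEFin; apply: lee_sum => i _; apply: ltW.
  exact: (sel_heavy sel).
rewrite -(big_mkord xpredT (fun i => ball_mass mu delta h (X i) (S i))).
rewrite -ge0_integral_bigsetU//=.
- by apply: ge0_subset_integral => //; apply: bigsetU_measurable => i _; exact: (measurable_rq_ball Q).
- by move=> i; exact: (measurable_rq_ball Q).
- exact: iota_uniq.
- apply: sub_trivIset (sel_disj sel) => i /=.
  by rewrite mem_index_iota.
- exact: measurable_funTS.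
Qed.

(* Radii are treated in decreasing order, choosing for each a maximal number of
   further disjoint balls; this number is bounded because a heavy ball of radius
   r carries at least l r^g of the finite mass I. *)
Lemma greedy_selection (rs : seq R) : (forall r, r \in rs -> (0 < r)%R) ->
  pairwise (fun r s : R => (s <= r)%R) rs -> I < +oo ->
  exists n X S, selection rs n X S /\ forall x r, r \in rs -> heavy x r ->
    exists2 i, (i < n)%N & (r <= S i)%R /\ B x r `&` B (X i) (S i) !=set0.
Proof.
elim/last_ind: rs => [_ _ _|rs r IH rs0 srs Ioo].
  exists 0%N, (fun=> point), (fun=> 0%R); split => //; split => //.
have rs0' s : s \in rs -> (0 < s)%R.
  by move=> srs'; apply: rs0; rewrite mem_rcons inE srs' orbT.
move: srs; rewrite pairwise_rcons => /andP[/allP r_le srs].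
have [n0 [X0 [S0 [sel0 cov0]]]] := IH rs0' srs Ioo.
have r0 : (0 < r)%R by apply: rs0; rewrite mem_rcons mem_head.
(* [P m]: the family found for the larger radii extends by m further disjoint heavy balls of radius
   r. *)
pose P m := exists X S, [/\ selection (rcons rs r) (n0 + m) X S,
  forall i, (i < n0)%N -> X i = X0 i /\ S i = S0 i &
  forall i, (n0 <= i)%N -> S i = r].
have P0 : P 0%N.
  exists X0, (fun i => if (i < n0)%N then S0 i else r); split.
  - rewrite addn0; split => [i ilt|i ilt|].
    + by rewrite ilt mem_rcons inE (sel_in sel0 ilt) orbT.
    + rewrite /= ilt; exact: (sel_heavy sel0 ilt).
    + move=> i j ilt jlt meet; move: meet.
      rewrite /= in ilt jlt *; rewrite ilt jlt.
      have := sel_disj sel0; apply; [exact: ilt|exact: jlt].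
  - by move=> i ilt; rewrite ilt.
  - by move=> i; rewrite leqNgt => /negbTE ->.
(* If every m were possible, truncn(I / (l r^g)) + 1 additional balls would carry a mass above the
   finite [I]. *)
have [m [X [S [sel XS Sr]]] nPm] : exists2 m, P m & ~ P m.+1.
  apply: contrapT => H.
  have allP m : P m.
    elim: m => // m Pm; apply: contrapT => nP; apply: H; by exists m.
  have [X [S [sel XS Sr]]] := allP (Num.truncn (fine I / (l * r `^ g))).+1.
  have Ifin : I \is a fin_num by rewrite ge0_fin_numE// integral_ge0.
  have := selection_sum rs0 sel; rewrite leNgt => /negP; apply.
  rewrite -(fineK Ifin) lte_fin big_split_ord/=.
  have lr0 : (0 < l * r `^ g)%R by rewrite mulr_gt0// powR_gt0.
  apply: (@lt_le_trans _ _ ((Num.truncn (fine I / (l * r `^ g))).+1%:R * (l * r `^ g)))%R.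
    by rewrite -ltr_pdivrMr// truncnS_gt.
  rewrite -[leLHS]add0r lerD//.
    by apply: sumr_ge0 => i _; rewrite mulr_ge0 ?powR_ge0// ltW.
  under [leRHS]eq_bigr do rewrite Sr ?leq_addr//.
  by rewrite sumr_const card_ord mulr_natl.
(* A heavy ball of radius r that meets no selected ball of radius at least r could be appended,
   against the maximality of m. All selected radii are at least r, the list being decreasing. *)
exists (n0 + m)%N, X, S; split => // x s; rewrite mem_rcons inE => /predU1P[->{s}|srs'] xs.
  apply: contrapT => nmeet; apply: nPm.
  exists (fun i => if (i < n0 + m)%N then X i else x), (fun i => if (i < n0 + m)%N then S i else r).
  have nmeet' i : (i < n0 + m)%N -> B x r `&` B (X i) (S i) = set0.
    move=> ilt; apply: contrapT => /eqP/set0P meet; apply: nmeet; exists i => //; split => //.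
    have [ilt0|] := ltnP i n0; last by move=> /Sr ->.
    by have [_ ->] := XS _ ilt0; apply: r_le; exact: (sel_in sel0 ilt0).
  split.
  - split => [i _|i _|].
    + case: ifPn => [|_]; first exact: (sel_in sel).
      by rewrite mem_rcons mem_head.
    + by case: ifPn => //; exact: (sel_heavy sel).
    + move=> i j /=; rewrite addnS !ltnS [(i <= _)%N]leq_eqVlt [(j <= _)%N]leq_eqVlt.
      case/predU1P => [->|ilt]; case/predU1P => [->|jlt]; rewrite ?ltnn ?ilt ?jlt//.
      * by move=> /set0P/eqP; rewrite nmeet'.
      * by move=> /set0P/eqP; rewrite setIC nmeet'.
      * have := sel_disj sel; apply; [exact: ilt|exact: jlt].
  - by move=> i ilt; rewrite ltn_addr//; exact: XS.
  - by move=> i ni; case: ifPn => // _; exact: Sr.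
have [i ilt [sS meet]] := cov0 _ _ srs' xs; exists i; first by rewrite ltn_addr.
by have [-> ->] := XS _ ilt.
Qed.

Let A (rs : seq R) := [set x | exists2 r, r \in rs & heavy x r].

Let measurable_heavy r : measurable [set x | heavy x r].
Proof.
rewrite -[X in measurable X]setTI; apply: emeasurable_fun_o_infty => //.
exact: (measurable_ball_mass Q).
Qed.

Let measurable_A rs : measurable (A rs).
Proof.
elim: rs => [|r rs IH].
  by rewrite (_ : A _ = set0)//; apply/seteqP; split => x // -[].
rewrite (_ : A _ = [set x | heavy x r] `|` A rs); first exact: measurableU.
apply/seteqP; split => x.
  by case=> s; rewrite inE => /predU1P[->|srs] xs; [left|right; exists s].
by case=> [xr|[s srs xs]]; [exists r|exists s]; rewrite ?inE ?eqxx// srs orbT.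
Qed.

(** If B(x,r) meets a selected B(X,S) with r <= S, then delta X x < k (S + S), so x lies in the
    dilate B(X, 2kS). The measure v (2kS)^g of a dilate is v (2k)^g / l times the amount l S^g that
    the selected ball contributes to [selection_sum]. The bound does not depend on [rs]. *)
Let weak_type_finite rs : (forall r, r \in rs -> (0 < r)%R) ->
  mu (A rs) <= (v * (2 * k) `^ g / l)%:E * I.
Proof.
move=> rs0; have k1 := rq_k_ge1 Q; have v0 := rq_v_gt0 Q.
have k0 : (0 < 2 * k)%R by lra.
have c0 : (0 < v * (2 * k) `^ g / l)%R by rewrite divr_gt0// mulr_gt0// powR_gt0.
have [Ioo|] := ltP I +oo; last by rewrite leye_eq => /eqP ->; rewrite gt0_muley ?leey.
pose srs := sort (fun r s : R => (s <= r)%R) rs.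
have srs_rs r : (r \in srs) = (r \in rs) by rewrite mem_sort.
have srs0 r : r \in srs -> (0 < r)%R by rewrite srs_rs; exact: rs0.
have [|n [X [S [sel cov]]]] := greedy_selection srs0 _ Ioo.
  rewrite -sorted_pairwise; first by apply: sort_sorted => r s; exact: le_total.
  by move=> a b c ba ac; exact: le_trans ac ba.
have S0 i : (i < n)%N -> (0 < S i)%R by move=> ilt; apply: srs0; exact: (sel_in sel).
have mB i : measurable (B (X i) (2 * k * S i)%R) by exact: (measurable_rq_ball Q).
apply: (@le_trans _ _ (mu (\big[setU/set0]_(i < n) B (X i) (2 * k * S i)%R))).
  apply: le_measure; rewrite ?inE//; first exact: bigsetU_measurable.
  move=> x [r rrs xr]; rewrite -(bigcup_mkord n (fun i => B (X i) (2 * k * S i)%R)).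
  have [i ilt [rS [y [/= xy Xy]]]] := cov x r (etrans (srs_rs r) rrs) xr.
  exists i => //=; apply: (le_lt_trans (rq_triangle Q _ _ y)).
  have : (k * (delta (X i) y + delta x y) < k * (S i + S i))%R.
    by rewrite ltr_pM2l; [rewrite ltrD// (lt_le_trans xy)|lra].
  by move=> /lt_le_trans; apply; lra.
apply: (@le_trans _ _ (\sum_(i < n) mu (B (X i) (2 * k * S i)%R))).
  exact: (@Boole_inequality _ _ _ mu (fun i => B (X i) (2 * k * S i)%R)).
rewrite (eq_bigr (fun i : 'I_n => (v * (2 * k) `^ g / l * (l * S i `^ g))%:E)); last first.
  move=> i _; have Si0 := S0 _ (ltn_ord i).
  rewrite /B (rq_ball Q (X i) (mulr_gt0 k0 Si0)); congr EFin.
  rewrite (@powRM _ (2 * k)%R) ?(ltW k0) ?(ltW Si0)//.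
  by rewrite -!mulrA; congr (_ * (_ * _))%R; rewrite mulKf ?gt_eqF.
rewrite sumEFin -mulr_sumr EFinM; apply: lee_wpmul2l; first by rewrite lee_fin ltW.
exact: selection_sum sel.
Qed.

(** The finite lists of radii grow to all positive rationals, and the measure is continuous along
    the increasing sets [A (rs n)]. *)
Lemma weak_type : mu [set x | l%:E < maximal mu delta g h x] <=
  (v * (2 * k) `^ g / l)%:E * I.
Proof.
(* An index that encodes no rational yields 0, which the positivity filter in [rs] discards. *)
pose qr i : R := ratr (odflt 0%R (unpickle i)).
pose rs n := [seq qr i | i <- iota 0 n & (0 < qr i)%R].
have rs0 n r : r \in rs n -> (0 < r)%R.
  by case/mapP => i; rewrite mem_filter => /andP[qi0 _] ->.
have -> : [set x | l%:E < maximal mu delta g h x] = \bigcup_n A (rs n).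
  apply/seteqP; split => [x /=|x [n _ [r rn xr]] /=].
    move=> /(maximal_gtP Q _ (ltW (rq_g_gt0 Q)) mh h0 (ltW l0))[q q0 qF].
    exists (pickle q).+1 => //; exists (ratr q) => //.
    apply/mapP; exists (pickle q); last by rewrite /qr pickleK.
    by rewrite mem_filter mem_iota /qr pickleK/= q0 add0n ltnSn.
  apply/(maximal_gtP Q _ (ltW (rq_g_gt0 Q)) mh h0 (ltW l0)).
  case/mapP: rn => i; rewrite mem_filter => /andP[qi0 _] rE.
  by exists (odflt 0%R (unpickle i)) => //; rewrite -/(qr i) -rE.
have ndA : nondecreasing_seq (A \o rs).
  move=> m n mn; apply/subsetPset => x [r rm xr]; exists r => //.
  case/mapP: rm => i; rewrite mem_filter mem_iota/= add0n => /andP[qi0 im] ->.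
  by apply/mapP; exists i => //; rewrite mem_filter qi0 mem_iota/= add0n (leq_trans im).
have mA n : measurable ((A \o rs) n) by exact: measurable_A.
have cvA := nondecreasing_cvg_mu (mu := mu) mA (bigcupT_measurable _ mA) ndA.
rewrite -(cvg_lim _ cvA)//; apply: lime_le; first by apply/cvg_ex; eexists; exact: cvA.
by apply: nearW => n; apply: weak_type_finite; exact: rs0.
Qed.

End weak_type.

(** * Strong type (p,p) by Marcinkiewicz interpolation *)

Section strong_type.
Context d (T : measurableType d) (R : realType).
Context (mu : {sigma_finite_measure set T -> \bar R}).
Context (delta : T -> T -> R) (k v g : R).
Context (Q : regular_quasimetric mu delta k v g).
Local Open Scope ereal_scope.
Implicit Types (h : T -> \bar R).

(** [maximal] is normalised by t^g and not by the volume v t^g, so the constant function c has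
    maximal function c v. *)
Lemma maximal_le_add_cst h h1 (c : R) x : (0 <= c)%R ->
  measurable_fun setT h -> (forall y, 0 <= h y) ->
  measurable_fun setT h1 -> (forall y, 0 <= h1 y) ->
  (forall y, h y <= h1 y + c%:E) ->
  maximal mu delta g h x <= maximal mu delta g h1 x + (c * v)%:E.
Proof.
move=> c0 mh h0 mh1 h10 hh1; apply: ge_ereal_sup => z [t /=].
rewrite in_itv/= andbT => t0 <-{z}.
apply: (@le_trans _ _ ((t `^ (- g))%:E * (ball_mass mu delta h1 x t + c%:E * (v * t `^ g)%:E))).
  apply: lee_wpmul2l; first by rewrite lee_fin powR_ge0.
  rewrite -(rq_ball Q x t0) -integral_cst; last exact: (measurable_rq_ball Q).
  rewrite /ball_mass -ge0_integralD//; [|exact: (measurable_rq_ball Q)|exact: measurable_funTS].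
  by apply: ge0_le_lower_integral => y _.
rewrite ge0_muleDr ?ball_mass_ge0//; last by rewrite mule_ge0 ?lee_fin// mulr_ge0 ?powR_ge0// ltW// (rq_v_gt0 Q).
apply: leeD.
  by apply: ereal_sup_ubound; exists t => //=; rewrite in_itv/= t0.
have tg0 : (t `^ g != 0)%R by rewrite gt_eqF// powR_gt0.
rewrite -!EFinM lee_fin powRN le_eqVlt; apply/orP; left; apply/eqP.
by field.
Qed.

Lemma mule_poweR (x : \bar R) (p : R) : (1 < p)%R -> 0 <= x -> x * x `^ (p - 1) = x `^ p.
Proof.
move=> p1; have p0 : (0 < p - 1)%R by rewrite subr_gt0.
case: x => [x x0| _|//].
  by rewrite !poweR_EFin -EFinM mulr_powRB1// (lt_trans _ p1).
by rewrite !poweRyr ?gt_eqF// ?mulyy// (lt_trans _ p1).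
Qed.

Lemma measurable_fun_poweR h (p : R) : measurable_fun setT h ->
  measurable_fun setT (fun x => h x `^ p).
Proof.
move=> mh; apply: (@measurableT_comp _ _ _ _ _ _ (fun y : \bar R => y `^ p)) => //.
exact: measurable_poweR.
Qed.

(** Here v (2k)^g is the weak-type constant, the leading 2 comes from using it at height t/2,
    p/(p-1) from the two layer cakes with exponents p and p-1, and (2v)^{p-1} from cutting h at
    height t/(2v). *)
Definition strong_type_constant (p : R) : R :=
  2 * (v * (2 * k) `^ g) * p / (p - 1) * (2 * v) `^ (p - 1).

(* Marcinkiewicz: at height t only the part of h exceeding t / (2v) matters, the
   rest having maximal function at most t / 2. *)
Lemma strong_type (p : R) h : (1 < p)%R ->
  measurable_fun setT h -> (forall y, 0 <= h y) ->
  \int[mu]_x maximal mu delta g h x `^ p <=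
  (strong_type_constant p)%:E * \int[mu]_x h x `^ p.
Proof.
move=> p1 mh h0; have p10 : (0 < p - 1)%R by rewrite subr_gt0.
have p0 : (0 < p)%R by exact: lt_trans p1.
have v0 := rq_v_gt0 Q; have g0 := rq_g_gt0 Q; have k1 := rq_k_ge1 Q.
have v20 : (0 < 2 * v)%R by rewrite mulr_gt0.
have A0 : (0 < v * (2 * k) `^ g)%R by rewrite mulr_gt0// powR_gt0//; lra.
have mMh := measurable_maximal Q (ltW g0) mh h0.
have Mh0 x : 0 <= maximal mu delta g h x by exact: maximal_ge0.
pose h2 x := (2 * v)%:E * h x.
have mh2 : measurable_fun setT h2 by exact: measurable_funeM.
have h20 x : 0 <= h2 x by rewrite mule_ge0// lee_fin ltW.
have lc1 := layer_cake mu p0 (measurable_cst (1 : \bar R)) (fun=> lee01) mMh Mh0.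
under eq_integral do rewrite -[_ `^ p]mul1e.
rewrite lc1.
(* Chosen so that p t^{p-1} times the weak-type factor v (2k)^g / (t/2) equals c times the
   layer-cake density (p-1) t^{p-2}. *)
pose c := (2 * (v * (2 * k) `^ g) * p / (p - 1))%R.
have c0 : (0 < c)%R by rewrite divr_gt0// mulr_gt0// mulr_gt0.
pose ch x := c%:E * h x.
have mch : measurable_fun setT ch by exact: measurable_funeM.
have ch0 x : 0 <= ch x by rewrite mule_ge0// lee_fin ltW.
apply: (@le_trans _ _ (\int[mu]_x (ch x * h2 x `^ (p - 1)))); last first.
  rewrite (eq_integral (fun x => (strong_type_constant p)%:E * h x `^ p)).
    rewrite ge0_integralZl//; [exact: measurable_fun_poweR| |].
      by move=> x _; exact: poweR_ge0.
    by rewrite lee_fin mulr_ge0 ?powR_ge0// ltW.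
  move=> x _; rewrite /ch /h2 poweRM ?lee_fin ?(ltW v20)// poweR_EFin muleACA mule_poweR//.
rewrite (layer_cake mu p10 mch ch0 mh2 h20).
  apply: ge0_le_lower_integral => t; rewrite /= in_itv/= andbT => t0.
    by rewrite mule_ge0 ?integral_ge0// lee_fin mulr_ge0 ?powR_ge0// ltW.
  have mD : measurable [set x | t%:E < h2 x].
    by rewrite -[X in measurable X]setTI; exact: emeasurable_fun_o_infty.
  pose h1 := h \_ [set x | t%:E < h2 x].
  have mh1 : measurable_fun setT h1.
    by apply: (measurable_restrictT _ mD).1; exact: measurable_funTS.
  have h10 x : 0 <= h1 x by exact: erestrict_ge0.
  have t20 : (0 < t / 2)%R by rewrite divr_gt0.
  have := weak_type Q mh1 h10 t20; rewrite -integral_mkcond => wt.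
  apply: (@le_trans _ _ ((p * t `^ (p - 1))%:E * (((v * (2 * k) `^ g) / (t / 2))%:E *
      \int[mu]_(x in [set x | t%:E < h2 x]) h x))).
    apply: lee_wpmul2l; first by rewrite lee_fin mulr_ge0 ?powR_ge0// ltW.
    apply: le_trans wt; rewrite integral_cst; last first.
      by rewrite -[X in measurable X]setTI; exact: emeasurable_fun_o_infty.
    rewrite mul1e; apply: le_measure; rewrite ?inE//.
    - by rewrite -[X in measurable X]setTI; exact: emeasurable_fun_o_infty.
    - rewrite -[X in measurable X]setTI; apply: emeasurable_fun_o_infty => //.
      exact: (measurable_maximal Q (ltW g0) mh1 h10).
    move=> x /= tx.
    have hh1 y : h y <= h1 y + (t / (2 * v))%:E.
      rewrite /h1 patchE; case: ifPn => [_|].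
        by rewrite leeDl// lee_fin divr_ge0// ltW.
      rewrite notin_setE/= => /negP; rewrite -leNgt /h2 add0e.
      by rewrite muleC -lee_pdivlMr.
    have := lt_le_trans tx (maximal_le_add_cst x (ltW (divr_gt0 t0 v20)) mh h0 mh1 h10 hh1).
    have -> : (t / (2 * v) * v = t / 2)%R by field; rewrite gt_eqF.
    by rewrite -lteBlDr// -EFinB; have -> : (t - t / 2 = t / 2)%R by field.
  rewrite ge0_integralZl//; last 2 first.
  - exact: measurable_funTS.
  - by rewrite lee_fin ltW.
  rewrite !muleA -!EFinM; apply: lee_wpmul2r; first exact: integral_ge0.
  rewrite lee_fin le_eqVlt; apply/orP; left; apply/eqP.
  have -> : (t `^ (p - 1 - 1) = t `^ (p - 1) / t)%R.
    by rewrite powRB ?(gt_eqF t0) ?implybT// powRr1// ltW.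
  by rewrite /c; field; rewrite !gt_eqF.
Qed.

End strong_type.

Section morrey_estimates.
Context d (T : measurableType d) (R : realType).
Context (mu : {sigma_finite_measure set T -> \bar R}).
Context (delta : T -> T -> R) (k v g : R).
Context (Q : regular_quasimetric mu delta k v g).
Local Open Scope ereal_scope.

(** * Generalized Morrey spaces *)

(* Replaces Hoelder's inequality: the right-hand side is integrated over a ball
   and l is taken to be phi^(1/p). *)
Lemma lee_young (p l : R) (y : \bar R) : (1 <= p)%R -> (0 < l)%R -> 0 <= y ->
  y <= l%:E + (l `^ (1 - p))%:E * y `^ p.
Proof.
move=> p1 l0; have p0 : (0 < p)%R by exact: lt_le_trans p1.
case: y => [y y0| _|//]; last first.
  by rewrite poweRyr ?gt_eqF// gt0_muley ?lte_fin ?powR_gt0// addey.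
rewrite poweR_EFin -EFinM -EFinD lee_fin.
have [yl|ly] := leP y l.
  by rewrite ler_wpDr// mulr_ge0// powR_ge0.
rewrite ler_wpDl ?(ltW l0)//.
have y00 : (0 < y)%R by exact: lt_trans ly.
have {1}-> : (y = y `^ (1 - p) * y `^ p)%R.
  by rewrite -powRD ?(gt_eqF y00) ?implybT// subrK powRr1.
apply: ler_wpM2r; first exact: powR_ge0.
rewrite -opprB !powRN lef_pV2 ?posrE ?powR_gt0//.
by apply: ge0_ler_powR; rewrite ?nnegrE ?(ltW l0) ?(ltW ly)// subr_ge0.
Qed.

Lemma poweRD_le (p b : R) (a : \bar R) : (0 <= p)%R -> 0 <= a -> (0 <= b)%R ->
  (a + b%:E) `^ p <= (2 `^ p)%:E * (a `^ p + (b `^ p)%:E).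
Proof.
move=> p0 a0 b0; rewrite -!poweR_EFin.
apply: (@le_trans _ _ ((2%:E * maxe a b%:E) `^ p)).
  apply: gt0_ler_poweR => //; rewrite ?in_itv/= ?leey ?andbT ?adde_ge0 ?lee_fin//.
    by rewrite mule_ge0 ?lee_fin// le_max a0.
  have [ab|ba] := leP a b%:E; rewrite mule_natl mule2n; apply: leeD => //; exact: ltW.
rewrite poweRM ?lee_fin ?le_max ?a0//; apply: lee_wpmul2l; first exact: poweR_ge0.
by have [ab|ba] := leP a b%:E; [rewrite leeDr|rewrite leeDl]; rewrite ?poweR_ge0.
Qed.

Section local.
Context (p : R) (p1 : (1 <= p)%R).
Context (h : T -> \bar R) (mh : measurable_fun setT h) (h0 : forall y, 0 <= h y).
Let B x r := [set y | (delta x y < r)%R].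

(** Integrate [lee_young] over the ball: the constant term gives l |B|, and the power term gives
    l^{1-p} K l^p |B| = K l |B|. The price compared with Hoelder's inequality is 1 + K in place of
    K^{1/p}. *)
Lemma ball_mass_le x t (K l : R) : (0 < l)%R -> (0 < t)%R ->
  \int[mu]_(y in B x t) h y `^ p <= (K * l `^ p * (v * t `^ g))%:E ->
  ball_mass mu delta h x t <= ((1 + K) * l * (v * t `^ g))%:E.
Proof.
move=> l0 t0 H; have mB := measurable_rq_ball Q x t.
apply: (@le_trans _ _ (\int[mu]_(y in B x t) (l%:E + (l `^ (1 - p))%:E * h y `^ p))).
  by apply: ge0_le_lower_integral => y _ //; exact: lee_young.
have mhp : measurable_fun (B x t) (fun y => h y `^ p).
  by apply: measurable_funTS; exact: measurable_fun_poweR.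
have lhp0 y : B x t y -> 0 <= (l `^ (1 - p))%:E * h y `^ p.
  by move=> _; rewrite mule_ge0 ?lee_fin ?powR_ge0// poweR_ge0.
have ll0 (y : T) : B x t y -> 0 <= l%:E by rewrite lee_fin ltW.
have mlhp : measurable_fun (B x t) (fun y => (l `^ (1 - p))%:E * h y `^ p).
  exact: measurable_funeM.
rewrite (ge0_integralD mu mB ll0 _ lhp0 mlhp)//.
have -> : \int[mu]_(_ in B x t) l%:E = l%:E * (v * t `^ g)%:E.
  by rewrite -(rq_ball Q x t0) -integral_cst.
rewrite ge0_integralZl ?lee_fin ?powR_ge0//; last by move=> y _; exact: poweR_ge0.
apply: (@le_trans _ _ (l%:E * (v * t `^ g)%:E + (l `^ (1 - p))%:E * (K * l `^ p * (v * t `^ g))%:E)).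
  by rewrite leeD2l// lee_wpmul2l// lee_fin powR_ge0.
rewrite -!EFinM -EFinD lee_fin le_eqVlt; apply/orP; left; apply/eqP.
have -> : (l `^ (1 - p) = l / l `^ p)%R by rewrite powRB ?(gt_eqF l0) ?implybT// powRr1// ltW.
by field; rewrite gt_eqF// powR_gt0.
Qed.

(* For z in B(x,r), a ball B(z,t) lies in B(x,2kr) if t <= r and in B(x,2kt) if
   t > r. *)
Lemma maximal_local x z r (c : R) : (0 < r)%R -> B x r z ->
  (forall t, (r < t)%R -> ball_mass mu delta h x t <= (c * t `^ g)%:E) ->
  maximal mu delta g h z <=
  maximal mu delta g (h \_ (B x (2 * k * r)%R)) z + (c * (2 * k) `^ g)%:E.
Proof.
move=> r0 xz Hc; have k1 := rq_k_ge1 Q.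
have kk0 : (0 < 2 * k)%R by lra.
have h10 y : 0 <= (h \_ (B x (2 * k * r)%R)) y by exact: erestrict_ge0.
have c0 : 0 <= (c * (2 * k) `^ g)%:E.
  have := le_trans (ball_mass_ge0 mu delta x (2 * r) h0) (Hc (2 * r)%R _).
  rewrite !lee_fin => H; rewrite mulr_ge0 ?powR_ge0//.
  rewrite -(@pmulr_lge0 _ ((2 * r) `^ g)); last by rewrite powR_gt0// mulr_gt0.
  by apply: H; lra.
apply: ge_ereal_sup => w [t /=]; rewrite in_itv/= andbT => t0 <-{w}.
have tri y : B z t y -> (delta x y < k * (r + t))%R.
  move=> /= zy; apply: (le_lt_trans (rq_triangle Q x y z)).
  by rewrite ltr_pM2l; [rewrite ltrD// (rq_sym Q)|lra].
have [tr|rt] := leP t r.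
  apply: (@le_trans _ _ (maximal mu delta g (h \_ (B x (2 * k * r)%R)) z)); last by rewrite leeDl.
  apply: le_ereal_sup_tmp; exists ((t `^ (- g))%:E * ball_mass mu delta (h \_ (B x (2 * k * r)%R)) z t).
    by exists t => //; rewrite /= in_itv/= t0.
  apply: lee_wpmul2l; first by rewrite lee_fin powR_ge0.
  apply: ge0_le_lower_integral => // y zy; rewrite patchE ifT// inE.
  apply: (lt_le_trans (tri _ zy)).
  have : (k * (r + t) <= k * (r + r))%R by rewrite ler_pM2l ?lerD2l//; lra.
  by move=> /le_trans; apply; lra.
apply: (@le_trans _ _ (c * (2 * k) `^ g)%:E); last by rewrite leeDr// maximal_ge0.
rewrite powRN lee_pdivrMl ?powR_gt0//.
apply: (@le_trans _ _ (ball_mass mu delta h x (2 * k * t))).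
  apply: ge0_subset_integral => //; try exact: (measurable_rq_ball Q).
    exact: measurable_funTS.
  move=> y zy /=; apply: (lt_le_trans (tri _ zy)).
  have : (k * (r + t) <= k * (t + t))%R by rewrite ler_pM2l ?lerD2r ?(ltW rt)//; lra.
  by move=> /le_trans; apply; lra.
apply: (le_trans (Hc _ _)).
  have : (1 * t < 2 * k * t)%R by rewrite ltr_pM2r//; lra.
  by rewrite mul1r; exact: lt_trans.
rewrite -EFinM lee_fin (@powRM _ (2 * k)%R) ?(ltW kk0) ?(ltW t0)// le_eqVlt.
by apply/orP; left; apply/eqP; ring.
Qed.

End local.
End morrey_estimates.

(** * The maximal function on generalized Morrey spaces *)

Section morrey_maximal.
Context d (T : measurableType d) (R : realType).
Context (mu : {sigma_finite_measure set T -> \bar R}).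
Context (delta : T -> T -> R) (k v g : R).
Context (Q : regular_quasimetric mu delta k v g).
Context (p C : R) (p1 : 1 <= p) (C0 : 0 < C).
Context (phi : T -> R -> R) (phi_gt0 : forall x t, 0 < t -> 0 < phi x t).
Context (h : T -> \bar R) (mh : measurable_fun setT h) (h0 : forall y, (0 <= h y)%E).
Local Open Scope ereal_scope.
Context (hloc : forall x t, (0 < t)%R ->
  \int[mu]_(y in [set y | (delta x y < t)%R]) h y `^ p <= (phi x t * (v * t `^ g))%:E).
Context (hsup : forall x r t, (0 < r)%R -> (r < t)%R ->
  \int[mu]_(y in [set y | (delta x y < t)%R]) h y `^ p <= (C * phi x r * (v * t `^ g))%:E).
Let B x r := [set y | (delta x y < r)%R].

Let p0 : (0 < p)%R. Proof. exact: lt_le_trans p1. Qed.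

Let phi_powK x r : (0 < r)%R -> ((phi x r `^ p^-1) `^ p = phi x r)%R.
Proof.
by move=> r0; rewrite -powRrM mulVf ?gt_eqF// powRr1// ltW// phi_gt0.
Qed.

(** The bound of [ball_mass_le] for l = phi(x,r)^{1/p} and K = C, with t^g taken out. *)
Let c x r := ((1 + C) * phi x r `^ p^-1 * v)%R.

Let c_ge0 x r : (0 < r)%R -> (0 < c x r)%R.
Proof.
move=> r0; rewrite mulr_gt0// ?(rq_v_gt0 Q)// mulr_gt0//; first by rewrite addr_gt0.
by rewrite powR_gt0// phi_gt0.
Qed.

Let split_maximal x z r : (0 < r)%R -> B x r z ->
  maximal mu delta g h z <=
  maximal mu delta g (h \_ (B x (2 * k * r)%R)) z + (c x r * (2 * k) `^ g)%:E.
Proof.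
move=> r0 xz; apply: (maximal_local Q mh h0 r0 xz) => t rt.
rewrite /c -mulrA; apply: (ball_mass_le Q p1 mh h0).
- by rewrite powR_gt0// phi_gt0.
- exact: lt_trans rt.
- by rewrite phi_powK//; exact: hsup.
Qed.

Let near_part x r : (0 < r)%R ->
  \int[mu]_y (h \_ (B x (2 * k * r)%R)) y `^ p <= (C * phi x r * (v * (2 * k * r) `^ g))%:E.
Proof.
move=> r0; have k1 := rq_k_ge1 Q.
have -> : \int[mu]_y (h \_ (B x (2 * k * r)%R)) y `^ p =
    \int[mu]_(y in B x (2 * k * r)%R) h y `^ p.
  rewrite [RHS]integral_mkcond; apply: eq_integral => y _; rewrite !patchE.
  by case: ifPn => // _; rewrite poweR0r// gt_eqF.
apply: hsup => //; have : (1 * r < 2 * k * r)%R by rewrite ltr_pM2r//; lra.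
by rewrite mul1r.
Qed.

Let mh1 x r : measurable_fun setT (h \_ (B x r)).
Proof.
apply: (measurable_restrictT _ (measurable_rq_ball Q x r)).1.
exact: measurable_funTS.
Qed.

Let h10 x r y : 0 <= (h \_ (B x r)) y. Proof. exact: erestrict_ge0. Qed.

(** The factor 2^p separates the two parts of the maximal function. The first summand is the strong
    type bound for the near part, on B(x,2kr); the second is the p-th power of the far constant. *)
Definition morrey_strong_constant : R :=
  2 `^ p * (strong_type_constant k v g p * (C * (2 * k) `^ g) +
            ((1 + C) * v * (2 * k) `^ g) `^ p).

Lemma morrey_maximal_strong x r : (1 < p)%R -> (0 < r)%R ->
  \int[mu]_(y in B x r) maximal mu delta g h y `^ p <=
  (morrey_strong_constant * (phi x r * (v * r `^ g)))%:E.
Proof.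
move=> p_gt1 r0; have k1 := rq_k_ge1 Q; have v0 := rq_v_gt0 Q.
have k20 : (0 < 2 * k)%R by lra.
have mB : measurable (B x r) by exact: (measurable_rq_ball Q).
pose b := (c x r * (2 * k) `^ g)%R.
have b0 : (0 <= b)%R by rewrite mulr_ge0 ?powR_ge0// ltW// c_ge0.
pose h1 := h \_ (B x (2 * k * r)%R).
have mM1 : measurable_fun setT (maximal mu delta g h1).
  exact: (measurable_maximal Q (ltW (rq_g_gt0 Q)) (@mh1 _ _) (@h10 _ _)).
have M10 y : 0 <= maximal mu delta g h1 y by apply: maximal_ge0; exact: h10.
have mM1p : measurable_fun setT (fun y => maximal mu delta g h1 y `^ p).
  exact: measurable_fun_poweR.
apply: (@le_trans _ _ (\int[mu]_(y in B x r)
    ((2 `^ p)%:E * (maximal mu delta g h1 y `^ p + (b `^ p)%:E)))).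
  apply: ge0_le_lower_integral => y xy; first exact: poweR_ge0.
  apply: le_trans (poweRD_le (ltW p0) (M10 y) b0).
  apply: gt0_ler_poweR; rewrite ?in_itv/= ?leey ?andbT ?(ltW p0)//.
  - exact: maximal_ge0.
  - by rewrite adde_ge0// lee_fin.
  - exact: split_maximal.
have mM1B : measurable_fun (B x r) (fun y => maximal mu delta g h1 y `^ p).
  exact: measurable_funTS.
have M1B0 y : B x r y -> 0 <= maximal mu delta g h1 y `^ p.
  by move=> _; exact: poweR_ge0.
have bB0 (y : T) : B x r y -> 0 <= (b `^ p)%:E by rewrite lee_fin powR_ge0.
have mbB : measurable_fun (B x r) (fun=> (b `^ p)%:E) by exact: measurable_cst.
have mDB : measurable_fun (B x r) (fun y => maximal mu delta g h1 y `^ p + (b `^ p)%:E).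
  exact: emeasurable_funD.
rewrite (ge0_integralZl _ mB mDB) ?lee_fin ?powR_ge0//; last first.
  by move=> y By; rewrite adde_ge0 ?M1B0// (bB0 y).
rewrite (ge0_integralD _ mB M1B0 mM1B bB0 mbB).
have -> : \int[mu]_(_ in B x r) (b `^ p)%:E = (b `^ p)%:E * (v * r `^ g)%:E.
  by rewrite -(rq_ball Q x r0) -integral_cst.
have S0 : (0 <= strong_type_constant k v g p)%R.
  rewrite !mulr_ge0 ?powR_ge0// ?(ltW v0) ?(ltW p0)//.
  by rewrite invr_ge0 subr_ge0 ltW.
have H1 : \int[mu]_(y in B x r) maximal mu delta g h1 y `^ p <=
    (strong_type_constant k v g p * (C * phi x r * (v * (2 * k * r) `^ g)))%:E.
  apply: (@le_trans _ _ (\int[mu]_y maximal mu delta g h1 y `^ p)).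
    by apply: ge0_subset_integral => // y _; exact: poweR_ge0.
  apply: (le_trans (strong_type Q p_gt1 (mh1 _ _) (h10 _ _))).
  rewrite [leRHS]EFinM; apply: lee_wpmul2l; first by rewrite lee_fin.
  exact: near_part.
apply: (@le_trans _ _ ((2 `^ p)%:E *
   ((strong_type_constant k v g p * (C * phi x r * (v * (2 * k * r) `^ g)))%:E +
    (b `^ p)%:E * (v * r `^ g)%:E))).
  by apply: lee_wpmul2l; [rewrite lee_fin powR_ge0|exact: leeD].
rewrite -!EFinM lee_fin le_eqVlt; apply/orP; left; apply/eqP.
rewrite /morrey_strong_constant (@powRM _ (2 * k)%R r) ?(ltW k20) ?(ltW r0)//.
have -> : (b = ((1 + C) * v * (2 * k) `^ g) * phi x r `^ p^-1)%R by rewrite /b /c; ring.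
rewrite (@powRM _ ((1 + C) * v * (2 * k) `^ g)%R) ?powR_ge0// ?phi_powK//; first by ring.
by rewrite !mulr_ge0 ?powR_ge0// ?(ltW v0)// addr_ge0// ltW.
Qed.

Definition morrey_weak_constant : R :=
  2 * ((1 + C) * v * (2 * k) `^ g) + 2 * (v * (2 * k) `^ g * (C * (2 * k) `^ g)).

(** Let b be the bound for the far part. If s <= 2b, the measure of the whole ball is already small
    enough, since 2b/s >= 1. If s > 2b, then s - b > s/2, so the near part alone has maximal
    function above s/2 and the weak type inequality applies. [morrey_weak_constant] adds the
    constants of the two cases. *)
Lemma morrey_maximal_weak x r s : p = 1%R -> (0 < r)%R -> (0 < s)%R ->
  mu (B x r `&` [set y | s%:E < maximal mu delta g h y]) <=
  (morrey_weak_constant / s * (phi x r * (v * r `^ g)))%:E.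
Proof.
move=> pE r0 s0; have k1 := rq_k_ge1 Q; have v0 := rq_v_gt0 Q.
have k20 : (0 < 2 * k)%R by lra.
have g0 := rq_g_gt0 Q.
have mB : measurable (B x r) by exact: (measurable_rq_ball Q).
pose b := (c x r * (2 * k) `^ g)%R.
have phi0 := phi_gt0 x r0.
have bE : (b = (1 + C) * v * (2 * k) `^ g * phi x r)%R.
  by rewrite /b /c pE invr1 powRr1 ?(ltW phi0)//; ring.
have mS h' : measurable_fun setT h' -> (forall y, 0 <= h' y) -> forall s,
    measurable [set y | s%:E < maximal mu delta g h' y].
  move=> mh' h'0 s'; rewrite -[X in measurable X]setTI.
  by apply: emeasurable_fun_o_infty => //; exact: (measurable_maximal Q (ltW g0)).
have rg0 : (0 < r `^ g)%R by rewrite powR_gt0.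
have kg0 : (0 < (2 * k) `^ g)%R by rewrite powR_gt0.
have C10 : (0 < 1 + C)%R by rewrite addr_gt0.
have [sb|bs] := leP s (2 * b)%R.
  apply: (@le_trans _ _ (mu (B x r))).
    by apply: le_measure; rewrite ?inE//; apply: measurableI => //; exact: mS.
  rewrite (rq_ball Q)// lee_fin.
  have -> : (morrey_weak_constant / s * (phi x r * (v * r `^ g)) =
      (morrey_weak_constant * phi x r / s) * (v * r `^ g))%R by field; rewrite gt_eqF.
  rewrite ler_peMl ?mulr_ge0 ?(ltW v0) ?(ltW rg0)// ler_pdivlMr// mul1r.
  apply: (le_trans sb); rewrite bE mulrA /morrey_weak_constant.
  by apply: ler_wpM2r; [exact: ltW|rewrite lerDl !mulr_ge0// ltW].
pose h1 := h \_ (B x (2 * k * r)%R).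
have s20 : (0 < s / 2)%R by rewrite divr_gt0.
apply: (@le_trans _ _ (mu [set y | (s / 2)%:E < maximal mu delta g h1 y])).
  apply: le_measure; rewrite ?inE//.
  - by apply: measurableI => //; exact: mS.
  - by apply: mS; [exact: mh1|exact: h10].
  move=> y [xy /= sy]; have := lt_le_trans sy (split_maximal r0 xy).
  rewrite -lteBlDr// -EFinB; apply: le_lt_trans; rewrite lee_fin.
  by rewrite -/b; lra.
apply: (le_trans (weak_type Q (mh1 _ _) (h10 _ _) s20)).
have H : \int[mu]_y h1 y <= (C * phi x r * (v * (2 * k * r) `^ g))%:E.
  apply: le_trans (near_part x r0); apply: ge0_le_lower_integral => y _.
    exact: h10.
  by rewrite pE poweRe1//; exact: h10.
apply: (@le_trans _ _ ((v * (2 * k) `^ g / (s / 2))%:E *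
    (C * phi x r * (v * (2 * k * r) `^ g))%:E)).
  by apply: lee_wpmul2l => //; rewrite lee_fin divr_ge0 ?mulr_ge0// ltW.
rewrite -EFinM lee_fin (@powRM _ (2 * k)%R r) ?(ltW k20) ?(ltW r0)//.
rewrite [leLHS](_ : _ = (2 * (v * (2 * k) `^ g * (C * (2 * k) `^ g))) / s * (phi x r * (v * r `^ g)))%R; last first.
  by field; rewrite gt_eqF.
rewrite ler_wpM2r ?mulr_ge0 ?(ltW phi0) ?(ltW v0) ?(ltW rg0)//.
rewrite ler_wpM2r ?invr_ge0 ?(ltW s0)// /morrey_weak_constant lerDr.
by rewrite !mulr_ge0// ltW.
Qed.

End morrey_maximal.

(** * Riesz potentials *)

Section hedberg.
Context d (T : measurableType d) (R : realType).
Context (mu : {sigma_finite_measure set T -> \bar R}).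
Context (delta : T -> T -> R) (k v g : R).
Context (Q : regular_quasimetric mu delta k v g).
Context (p q a C : R) (p1 : 1 <= p) (pq : p < q) (a0 : 0 < a) (ag : a < g).
Context (phi : T -> R -> R) (phi_gt0 : forall x t, 0 < t -> 0 < phi x t).
Context (h : T -> \bar R) (mh : measurable_fun setT h) (h0 : forall y, (0 <= h y)%E).
Local Open Scope ereal_scope.
Context (hloc : forall x t, (0 < t)%R ->
  \int[mu]_(y in [set y | (delta x y < t)%R]) h y `^ p <= (phi x t * (v * t `^ g))%:E).
Context (hint : forall x r, (0 < r)%R ->
  \int[lebesgue_measure]_(t in `]r, +oo[) (t `^ a * phi x t `^ p^-1 / t)%:E
    <= (C * r `^ (- (a * p / (q - p))))%:E).

Definition riesz (f : T -> \bar R) x : \bar R :=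
  \int[mu]_y (f y * (delta x y `^ (g - a))^-1%:E).

Let p0 : (0 < p)%R. Proof. exact: lt_le_trans p1. Qed.
Let q0 : (0 < q)%R. Proof. exact: lt_trans pq. Qed.
Let b := (g - a)%R.
Let b0 : (0 < b)%R. Proof. by rewrite subr_gt0. Qed.
Let be := (a * p / (q - p))%R.
Let be0 : (0 < be)%R. Proof. by rewrite divr_gt0 ?mulr_gt0// subr_gt0. Qed.

Let G x (t : measurableTypeR R) := (b * t `^ (- b - 1))%:E * ball_mass mu delta h x t.

Let mG x : measurable_fun setT (G x).
Proof.
apply: emeasurable_funM; first exact: measurable_powR_density.
exact: (measurable_ball_mass_radius Q).
Qed.

Let G0 x t : 0 <= G x t.
Proof.
by rewrite mule_ge0 ?ball_mass_ge0// lee_fin mulr_ge0 ?powR_ge0// ltW.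
Qed.

Let powR_combine (t s1 s2 : R) : (0 < t)%R -> (t `^ s1 * t `^ s2 = t `^ (s1 + s2))%R.
Proof. by move=> t0; rewrite powRD ?(gt_eqF t0) ?implybT. Qed.

(** One factor for both pieces: b/a comes from radii up to r, and 2vbC from radii beyond r. *)
Definition hedberg_constant : R := Num.max (b / a)%R (2 * v * b * C)%R.

Let tail_part x r : (0 < r)%R ->
  \int[lebesgue_measure]_(t in `]r, +oo[) G x t <= (2 * v * b * C * r `^ (- be))%:E.
Proof.
move=> r0; pose c := (2 * v * b)%R.
have c0 : (0 < c)%R by rewrite !mulr_gt0// (rq_v_gt0 Q).
(* The constant leaves the integral while the integrand is still the measurable [G]; the comparison
   that follows involves phi(x,.), whose measurability in t is not at hand. *)
have -> : \int[lebesgue_measure]_(t in `]r, +oo[) G x t =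
    c%:E * \int[lebesgue_measure]_(t in `]r, +oo[) (c^-1%:E * G x t).
  rewrite -ge0_integralZl ?lee_fin ?(ltW c0)//.
  - apply: eq_integral => t _.
    by rewrite muleA -EFinM divff ?mul1e// gt_eqF.
  - by apply: measurable_funeM; exact: measurable_funTS.
  - by move=> t _; rewrite mule_ge0// lee_fin invr_ge0 ltW.
have -> : (2 * v * b * C * r `^ (- be))%:E = c%:E * (C * r `^ (- be))%:E.
  by rewrite -EFinM mulrA.
apply: lee_wpmul2l; first by rewrite lee_fin ltW.
apply: le_trans (hint x r0); apply: ge0_le_lower_integral => t.
  by move=> _; rewrite mule_ge0// lee_fin invr_ge0 ltW.
rewrite /= in_itv/= andbT => rt; have t0 : (0 < t)%R by exact: lt_trans rt.
have phi0 := phi_gt0 x t0.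
(* [ball_mass_le] with K = 1 and l = phi(x,t)^{1/p}, which is the source of the 2 in [c]. The powers
   of t then combine to t^a / t because g - b = a. *)
have F : ball_mass mu delta h x t <= ((1 + 1) * phi x t `^ p^-1 * (v * t `^ g))%:E.
  apply: (ball_mass_le Q p1 mh h0) => //; first by rewrite powR_gt0.
  rewrite mul1r -powRrM mulVf ?gt_eqF// powRr1 ?(ltW phi0)//; exact: hloc.
rewrite /G muleA -EFinM.
apply: (@le_trans _ _ ((c^-1 * (b * t `^ (- b - 1)))%:E *
    ((1 + 1) * phi x t `^ p^-1 * (v * t `^ g))%:E)).
  apply: lee_wpmul2l => //.
  by rewrite lee_fin !mulr_ge0 ?powR_ge0 ?invr_ge0// ltW.
rewrite -EFinM lee_fin le_eqVlt; apply/orP; left; apply/eqP.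
have -> : (t `^ a = t `^ (- b - 1) * t `^ g * t)%R.
  rewrite powR_combine// -[X in (_ * X)%R]powRr1 ?(ltW t0)// powR_combine//.
  by congr (_ `^ _)%R; rewrite /b; ring.
by rewrite /c; field; rewrite !gt_eqF// (rq_v_gt0 Q).
Qed.

Let head_part x r (m : R) : (0 < r)%R -> maximal mu delta g h x = m%:E ->
  \int[lebesgue_measure]_(t in `]0%R, r]) G x t <= (b / a * r `^ a * m)%:E.
Proof.
move=> r0 Mm.
have m0 : (0 <= m)%R by rewrite -lee_fin -Mm maximal_ge0.
apply: (@le_trans _ _ (\int[lebesgue_measure]_(t in `]0%R, r])
   ((b / a * m)%:E * (a * t `^ (a - 1))%:E))).
  apply: ge0_le_lower_integral => t; rewrite /= in_itv/= => /andP[t0 _] //.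
  have F : ball_mass mu delta h x t <= (t `^ g * m)%:E.
    rewrite EFinM -Mm -lee_pdivrMl ?powR_gt0// -powRN.
    by apply: ereal_sup_ubound; exists t => //; rewrite /= in_itv/= t0.
  apply: (@le_trans _ _ ((b * t `^ (- b - 1))%:E * (t `^ g * m)%:E)).
    by apply: lee_wpmul2l => //; rewrite lee_fin mulr_ge0 ?powR_ge0// ltW.
  rewrite -!EFinM lee_fin le_eqVlt; apply/orP; left; apply/eqP.
  have -> : (t `^ (a - 1) = t `^ (- b - 1) * t `^ g)%R.
    by rewrite powR_combine//; congr (_ `^ _)%R; rewrite /b; ring.
  by field; rewrite gt_eqF.
have mp := @measurable_powR_density R a (a - 1)%R.
rewrite ge0_integralZl//; last 3 first.
- exact: measurable_funTS.
- by move=> t _; rewrite lee_fin mulr_ge0 ?powR_ge0// ltW.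
- by rewrite lee_fin mulr_ge0// divr_ge0// ltW.
rewrite -integral_itv_bndo_bndc; last exact: measurable_funTS.
by rewrite integral_powR_head// -EFinM mulrAC.
Qed.

Let riesz_split x r (m : R) : (0 < r)%R -> maximal mu delta g h x = m%:E ->
  riesz h x <= (hedberg_constant * (r `^ a * m + r `^ (- be)))%:E.
Proof.
move=> r0 Mm.
have m0 : (0 <= m)%R by rewrite -lee_fin -Mm maximal_ge0.
have mdx : measurable_fun setT (delta x).
  exact: (measurable_fun_pair2 x (rq_measurable Q)).
apply: (le_trans (layer_cake_tail mu b0 mh h0 mdx (rq_ge0 Q x))).
have -> : `]0%R, +oo[%classic = `]0%R, r]%classic `|` `]r, +oo[%classic :> set R.
  apply/seteqP; split => t /=; rewrite !in_itv/= !andbT.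
    by move=> t0; have [tr|rt] := leP t r; [left|right]; rewrite ?t0.
  by case=> [/andP[]//|]; exact: lt_trans.
rewrite ge0_integral_setU//=; last 3 first.
- by apply: measurable_funTS; exact: mG.
- by move=> t _; exact: G0.
- rewrite disj_set2E; apply/eqP/seteqP; split => t //=; rewrite !in_itv/= andbT.
  by case=> /andP[_ tr] rt; move: (lt_le_trans rt tr); rewrite ltxx.
apply: (le_trans (leeD (head_part r0 Mm) (tail_part x r0))).
rewrite -EFinD lee_fin [leRHS]mulrDr; apply: lerD.
  rewrite -mulrA; apply: ler_wpM2r; first by rewrite mulr_ge0 ?powR_ge0.
  by rewrite le_max lexx.
by apply: ler_wpM2r; [exact: powR_ge0|rewrite le_max lexx orbT].
Qed.

Lemma hedberg_constant_gt0 : (0 < hedberg_constant)%R.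
Proof. by rewrite lt_max divr_gt0. Qed.

(** [hloc] amounts to a Morrey norm of at most one, hence no norm appears on the right. For 0 < m <
    oo, where m is the maximal function at x, the radius r = m^{-(q-p)/(aq)} makes r^a m and
    r^{-ap/(q-p)} both equal to m^{p/q}. *)
Lemma hedberg x :
  riesz h x <= (2 * hedberg_constant)%:E * maximal mu delta g h x `^ (p / q).
Proof.
have H0 := hedberg_constant_gt0.
have pq0 : (0 < p / q)%R by rewrite divr_gt0.
have : 0 <= maximal mu delta g h x by exact: maximal_ge0.
case Mm : (maximal mu delta g h x) => [m| |//] m0; last first.
  by rewrite poweRyr ?gt_eqF// gt0_muley ?leey// lte_fin mulr_gt0.
rewrite poweR_EFin; move: m0; rewrite lee_fin le_eqVlt => /predU1P[m0|m0].
  rewrite -m0 powR0 ?gt_eqF// mule0; apply/lee_addgt0Pr => e e0; rewrite add0e.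
  (* For m = 0 only r^{-be} remains; this r makes its multiple by [hedberg_constant] equal to e. *)
  pose r := ((e / hedberg_constant) `^ (- be^-1))%R.
  have r0 : (0 < r)%R by rewrite powR_gt0// divr_gt0.
  apply: (le_trans (riesz_split r0 Mm)); rewrite -m0 mulr0 add0r lee_fin.
  rewrite /r -powRrM mulrNN mulVf ?gt_eqF// powRr1 ?divr_ge0 ?(ltW e0) ?(ltW H0)//.
  by rewrite mulrCA divff ?mulr1// gt_eqF.
have qp0 : (0 < q - p)%R by rewrite subr_gt0.
pose r := (m `^ (- ((q - p) / (a * q))))%R.
have r0 : (0 < r)%R by rewrite powR_gt0.
apply: (le_trans (riesz_split r0 Mm)); rewrite -EFinM lee_fin.
have -> : (r `^ a * m = m `^ (p / q))%R.
  rewrite /r -powRrM -[X in (_ * X)%R]powRr1 ?(ltW m0)// powR_combine//.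
  by congr (_ `^ _)%R; field; rewrite !gt_eqF.
have -> : (r `^ (- be) = m `^ (p / q))%R.
  by rewrite /r -powRrM; congr (_ `^ _)%R; rewrite /be; field; rewrite !gt_eqF.
by rewrite le_eqVlt; apply/orP; left; apply/eqP; ring.
Qed.

End hedberg.

Section riesz_measurability.
Context d (T : measurableType d) (R : realType).
Context (mu : {sigma_finite_measure set T -> \bar R}).
Context (delta : T -> T -> R) (k v g : R).
Context (Q : regular_quasimetric mu delta k v g).
Local Open Scope ereal_scope.

Lemma measurable_riesz_kernel (a : R) :
  measurable_fun setT (fun z : T * T => (delta z.1 z.2 `^ (g - a))^-1%:E).
Proof.
apply/measurable_EFinP; under eq_fun do rewrite -powRN.
apply: (@measurableT_comp _ _ _ _ _ _ (fun s : R => s `^ (- (g - a)))%R).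
  exact: measurable_powR.
exact: (rq_measurable Q).
Qed.

Lemma measurable_riesz_kernel_section (a : R) (x : T) :
  measurable_fun setT (fun y => (delta x y `^ (g - a))^-1%:E).
Proof. by have := measurable_fun_pair2 x (measurable_riesz_kernel a). Qed.

Lemma measurable_riesz (a : R) (f : T -> \bar R) : measurable_fun setT f ->
  measurable_fun setT (riesz mu delta g a f).
Proof.
move=> mf.
pose K (z : T * T) := f z.2 * (delta z.1 z.2 `^ (g - a))^-1%:E.
have mK : measurable_fun setT K.
  by apply: emeasurable_funM; [exact: measurableT_comp|exact: measurable_riesz_kernel].
rewrite (_ : riesz _ _ _ _ _ = fun x =>
    \int[mu]_y (K^\+ (x, y)) - \int[mu]_y (K^\- (x, y))); last first.
  apply/funext => x; rewrite /riesz integralE.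
  by congr (_ - _); apply: eq_integral => y _; rewrite ?funeposE ?funenegE.
apply: emeasurable_funB.
- apply: (measurable_fun_fubini_tonelli_F (m2 := mu) K^\+) => //.
  exact: measurable_funepos.
- apply: (measurable_fun_fubini_tonelli_F (m2 := mu) K^\-) => //.
  exact: measurable_funeneg.
Qed.

Lemma le_abse_riesz (a : R) (f : T -> \bar R) x : measurable_fun setT f ->
  `|riesz mu delta g a f x| <= riesz mu delta g a (abse \o f) x.
Proof.
move=> mf; apply: le_trans (le_abse_integral _ measurableT _) _.
  apply: emeasurable_funM => //.
  exact: measurable_riesz_kernel_section.
apply: ge0_le_lower_integral => y _ //=.
by rewrite abseM [X in _ * X]gee0_abs// lee_fin invr_ge0 powR_ge0.
Qed.

End riesz_measurability.

(** * From the maximal function to the Riesz potential *)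

Section adams.
Context d (T : measurableType d) (R : realType).
Context (mu : {sigma_finite_measure set T -> \bar R}).
Context (delta : T -> T -> R) (k v g : R).
Context (Q : regular_quasimetric mu delta k v g).
Context (p q a C : R) (p1 : 1 <= p) (pq : p < q) (a0 : 0 < a) (ag : a < g) (C0 : 0 < C).
Context (phi : T -> R -> R) (phi_gt0 : forall x t, 0 < t -> 0 < phi x t).
Local Open Scope ereal_scope.
Context (phi_sup : forall x r, (0 < r)%R ->
  ereal_sup [set (t `^ (- g))%:E *
                 ess_inf (mrestr lebesgue_measure (measurable_itv `]t, +oo[))
                   (fun tau : R => (phi x tau * tau `^ g)%:E)
               | t in `]r, +oo[] <= (C * phi x r)%:E).
Context (phi_int : forall x r, (0 < r)%R ->
  \int[lebesgue_measure]_(t in `]r, +oo[) (t `^ a * phi x t `^ p^-1 / t)%:E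
    <= (C * r `^ (- (a * p / (q - p))))%:E).

Let p0 : (0 < p)%R. Proof. exact: lt_le_trans p1. Qed.
Let q0 : (0 < q)%R. Proof. exact: lt_trans pq. Qed.

Let B x r := [set y | (delta x y < r)%R].

(** A norm bound by N, raised to the power p and cleared of denominators. Taking any positive N
    above the norm avoids dividing by a norm that may vanish. *)
Definition morrey_bounded (h : T -> \bar R) (N : R) := forall x t, (0 < t)%R ->
  \int[mu]_(y in [set y | (delta x y < t)%R]) h y `^ p <=
  (N `^ p * (phi x t * (v * t `^ g)))%:E.

(* The integral over B(x,t) is at most the one over B(x,tau), hence at most
   v phi(x,tau) tau^g, for every tau > t. *)
Let sup_condition (h : T -> \bar R) (mh : measurable_fun setT h)
    (h0 : forall y, 0 <= h y) :
  (forall x t, (0 < t)%R -> \int[mu]_(y in B x t) h y `^ p <= (phi x t * (v * t `^ g))%:E) ->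
  forall x r t, (0 < r)%R -> (r < t)%R ->
    \int[mu]_(y in B x t) h y `^ p <= (C * phi x r * (v * t `^ g))%:E.
Proof.
move=> hloc x r t r0 rt; have t0 : (0 < t)%R by exact: lt_trans rt.
have v0 := rq_v_gt0 Q.
have mhp : measurable_fun setT (fun y => h y `^ p) by exact: measurable_fun_poweR.
set I := (leLHS).
have Ifin : I \is a fin_num.
  rewrite ge0_fin_numE ?integral_ge0//; last by move=> y _; exact: poweR_ge0.
  by apply: le_lt_trans (hloc x t t0) _; rewrite ltry.
have Iinf : (fine I / v)%:E <= ess_inf (mrestr lebesgue_measure (measurable_itv `]t, +oo[))
    (fun tau : R => (phi x tau * tau `^ g)%:E).
  rewrite ess_infEae; apply: ereal_sup_ubound => /=.
  (* The essential infimum is the supremum of the almost everywhere lower bounds. The exceptional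
     set is the complement of the ray, null for the restricted measure. *)
  exists (~` `]t, +oo[%classic); split.
  - exact: measurableC.
  - by rewrite /mrestr setICl measure0.
  move=> tau /= H; rewrite in_itv/= andbT => ttau; apply: H.
  have tau0 : (0 < tau)%R by exact: lt_trans ttau.
  rewrite lee_fin ler_pdivrMr// -lee_fin fineK//.
  rewrite mulrAC -mulrA; apply: le_trans (hloc x tau tau0).
  apply: ge0_subset_integral => //; try exact: (measurable_rq_ball Q).
  - exact: measurable_funTS.
  - by move=> y _; exact: poweR_ge0.
  - by move=> y /= /lt_trans; apply.
have := le_trans (ereal_sup_ubound _) (phi_sup x r0).
move=> /(_ _ (ex_intro2 _ _ t _ erefl)); rewrite /= in_itv/= andbT => /(_ rt).
move=> /(le_trans (lee_wpmul2l _ Iinf)); rewrite lee_fin powR_ge0 => /(_ isT).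
rewrite -EFinM lee_fin powRN -(fineK Ifin) lee_fin.
rewrite -(@ler_pM2l _ (v * t `^ g)) ?mulr_gt0 ?powR_gt0// => H.
rewrite [leRHS]mulrC; apply: le_trans H; rewrite le_eqVlt; apply/orP; left; apply/eqP.
by field; rewrite !gt_eqF// powR_gt0.
Qed.

Let rieszZ (c : R) (h : T -> \bar R) x : (0 <= c)%R ->
  measurable_fun setT h -> (forall y, 0 <= h y) ->
  riesz mu delta g a (fun y => c%:E * h y) x = c%:E * riesz mu delta g a h x.
Proof.
move=> c0 mh h0; rewrite /riesz -ge0_integralZl//.
- by apply: eq_integral => y _; rewrite muleA.
- apply: emeasurable_funM => //.
  exact: (measurable_riesz_kernel_section Q).
- by move=> y _; rewrite mule_ge0// lee_fin invr_ge0 powR_ge0.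
Qed.

Let Ha := hedberg_constant v g a C.
Let Ha0 : (0 < Ha)%R. Proof. exact: hedberg_constant_gt0. Qed.

Let normalize (h : T -> \bar R) (N : R) : (0 < N)%R ->
  measurable_fun setT h -> (forall y, 0 <= h y) -> morrey_bounded h N ->
  forall x t, (0 < t)%R -> \int[mu]_(y in B x t) (N^-1%:E * h y) `^ p <=
    (phi x t * (v * t `^ g))%:E.
Proof.
move=> N0 mh h0 hN x t t0.
have Np0 : (0 < N `^ p)%R by rewrite powR_gt0.
have -> : \int[mu]_(y in B x t) (N^-1%:E * h y) `^ p =
    ((N `^ p)^-1)%:E * \int[mu]_(y in B x t) h y `^ p.
  rewrite -ge0_integralZl//.
  - apply: eq_integral => y _; rewrite poweRM ?lee_fin ?invr_ge0 ?(ltW N0)//.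
    by rewrite poweR_EFin -powR_inv1 ?(ltW N0)// -powRrM mulN1r powRN.
  - exact: (measurable_rq_ball Q).
  - by apply: measurable_funTS; exact: measurable_fun_poweR.
  - by move=> y _; exact: poweR_ge0.
  - by rewrite lee_fin invr_ge0 ltW.
by rewrite lee_pdivrMl// -EFinM; exact: hN.
Qed.

Lemma riesz_ge0 h x : (forall y, 0 <= h y) -> 0 <= riesz mu delta g a h x.
Proof.
by move=> h0; apply: integral_ge0 => y _; rewrite mule_ge0// lee_fin invr_ge0 powR_ge0.
Qed.

Definition adams_strong_constant : R :=
  (2 * Ha) `^ q * morrey_strong_constant k v g p C.

(** By [hedberg] applied to h/N, the q-th power of the potential is at most (2 Ha N)^q times ((M
    h')^{p/q})^q = (M h')^p, and [morrey_maximal_strong] integrates the latter. *)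
Lemma adams_strong (h : T -> \bar R) (N : R) x r : (1 < p)%R -> (0 < N)%R ->
  measurable_fun setT h -> (forall y, 0 <= h y) -> morrey_bounded h N -> (0 < r)%R ->
  \int[mu]_(y in B x r) riesz mu delta g a h y `^ q <=
  (N `^ q * adams_strong_constant * (phi x r * (v * r `^ g)))%:E.
Proof.
move=> p_gt1 N0 mh h0 hN r0.
pose h' y := N^-1%:E * h y.
have mh' : measurable_fun setT h' by exact: measurable_funeM.
have h'0 y : 0 <= h' y by rewrite mule_ge0// lee_fin invr_ge0 ltW.
have hloc := normalize N0 mh h0 hN.
have hsup := sup_condition mh' h'0 hloc.
have mM : measurable_fun setT (maximal mu delta g h').
  exact: (measurable_maximal Q (ltW (rq_g_gt0 Q)) mh' h'0).
have c0 : (0 <= 2 * Ha * N)%R by rewrite !mulr_ge0// ltW.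
apply: (@le_trans _ _ (\int[mu]_(y in B x r)
    (((2 * Ha * N) `^ q)%:E * maximal mu delta g h' y `^ p))).
  apply: ge0_le_lower_integral => y _; first exact: poweR_ge0.
  have -> : maximal mu delta g h' y `^ p = (maximal mu delta g h' y `^ (p / q)) `^ q.
    by rewrite -poweRrM divfK// gt_eqF.
  rewrite -poweR_EFin -poweRM ?lee_fin ?poweR_ge0//.
  apply: gt0_ler_poweR; rewrite ?in_itv/= ?leey ?andbT ?(ltW q0)//.
  - exact: riesz_ge0.
  - by rewrite mule_ge0 ?lee_fin ?poweR_ge0.
  have hE : h = fun z => N%:E * h' z.
    by apply/funext => z; rewrite /h' muleA -EFinM divff ?mul1e// gt_eqF.
  rewrite hE rieszZ// ?(ltW N0)// mulrC EFinM -muleA; apply: lee_wpmul2l.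
    by rewrite lee_fin ltW.
  exact: (hedberg Q p1 pq a0 ag phi_gt0 mh' h'0 hloc phi_int).
rewrite ge0_integralZl//; last 4 first.
- exact: (measurable_rq_ball Q).
- by apply: measurable_funTS; exact: measurable_fun_poweR.
- by move=> y _; exact: poweR_ge0.
- by rewrite lee_fin powR_ge0.
apply: (le_trans (lee_wpmul2l _ (morrey_maximal_strong Q p1 C0 phi_gt0 mh' h'0 hsup x p_gt1 r0))).
  by rewrite lee_fin powR_ge0.
rewrite -EFinM lee_fin /adams_strong_constant.
rewrite (@powRM _ (2 * Ha)%R N) ?mulr_ge0 ?(ltW Ha0) ?(ltW N0)//.
by rewrite le_eqVlt; apply/orP; left; apply/eqP; ring.
Qed.

Definition adams_weak_constant : R :=
  (2 * Ha) `^ q * morrey_weak_constant k v g C.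

(** For p = 1, a potential above s forces M h' above (s / (2 Ha N))^q, by [hedberg]; this superlevel
    set of M h' inside the ball is the witness. A measurable superset is all that is needed to bound
    the integral of an indicator in the weak norm. *)
Lemma adams_weak (h : T -> \bar R) (N : R) x r s : p = 1%R -> (0 < N)%R ->
  measurable_fun setT h -> (forall y, 0 <= h y) -> morrey_bounded h N ->
  (0 < r)%R -> (0 < s)%R ->
  exists2 A : set T, measurable A /\ (B x r `&` [set y | s%:E < riesz mu delta g a h y]) `<=` A &
  mu A <= ((N / s) `^ q * adams_weak_constant * (phi x r * (v * r `^ g)))%:E.
Proof.
move=> pE N0 mh h0 hN r0 s0.
pose h' y := N^-1%:E * h y.
have mh' : measurable_fun setT h' by exact: measurable_funeM.
have h'0 y : 0 <= h' y by rewrite mule_ge0// lee_fin invr_ge0 ltW.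
have hloc := normalize N0 mh h0 hN.
have hsup := sup_condition mh' h'0 hloc.
have mM : measurable_fun setT (maximal mu delta g h').
  exact: (measurable_maximal Q (ltW (rq_g_gt0 Q)) mh' h'0).
pose c := (2 * Ha * N / s)%R.
have c0 : (0 < c)%R by rewrite divr_gt0// !mulr_gt0.
have cq0 : (0 < c `^ q)%R by rewrite powR_gt0.
exists (B x r `&` [set y | ((c `^ q)^-1)%:E < maximal mu delta g h' y]).
  split.
    apply: measurableI; first exact: (measurable_rq_ball Q).
    by rewrite -[X in measurable X]setTI; exact: emeasurable_fun_o_infty.
  move=> y [xy /= sy]; split => //=.
  have hE : h = fun z => N%:E * h' z.
    by apply/funext => z; rewrite /h' muleA -EFinM divff ?mul1e// gt_eqF.
  move: sy; rewrite hE rieszZ// ?(ltW N0)// => sy.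
  have M0 : 0 <= maximal mu delta g h' y by exact: maximal_ge0.
  rewrite ltNge; apply/negP => Mc; move: sy; apply/negP; rewrite -leNgt.
  apply: (@le_trans _ _ (N%:E * ((2 * Ha)%:E * (c^-1)%:E))).
    apply: lee_wpmul2l; first by rewrite lee_fin ltW.
    apply: (le_trans (hedberg Q p1 pq a0 ag phi_gt0 mh' h'0 hloc phi_int y)).
    apply: lee_wpmul2l; first by rewrite lee_fin mulr_ge0// ltW.
    have -> : (c^-1)%:E = ((c `^ q)^-1)%:E `^ (p / q).
      rewrite poweR_EFin pE -powRN -powRrM mul1r mulNr divff ?gt_eqF//.
      by rewrite powR_inv1// ltW.
    apply: gt0_ler_poweR; rewrite ?in_itv/= ?leey ?andbT ?divr_ge0 ?(ltW q0) ?(ltW p0)//.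
    by rewrite lee_fin invr_ge0 ltW.
  rewrite -!EFinM lee_fin /c le_eqVlt; apply/orP; left; apply/eqP.
  by field; rewrite !gt_eqF// mulr_gt0.
have cq0' : (0 < (c `^ q)^-1)%R by rewrite invr_gt0.
apply: (le_trans (morrey_maximal_weak Q p1 C0 phi_gt0 mh' h'0 hsup x pE r0 cq0')).
have -> : c = (2 * Ha * (N / s))%R by rewrite /c mulrA.
rewrite lee_fin invrK /adams_weak_constant.
have Ha20 : (0 <= 2 * Ha)%R by rewrite mulr_ge0// ltW.
have Ns0 : (0 <= N / s)%R by rewrite divr_ge0// ltW.
rewrite (powRM _ Ha20 Ns0).
by rewrite le_eqVlt; apply/orP; left; apply/eqP; ring.
Qed.

End adams.

(** * The fractional maximal function below the Riesz potential *)

Section maximal_riesz.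
Context d (T : measurableType d) (R : realType).
Context (mu : {sigma_finite_measure set T -> \bar R}).
Context (delta : T -> T -> R) (k v g : R).
Context (Q : regular_quasimetric mu delta k v g).
Local Open Scope ereal_scope.

Let degenerate x := [set y | (delta x y <= 0)%R].

Let measurable_degenerate x : measurable (degenerate x).
Proof.
rewrite -[X in measurable X]setTI.
have m1 : measurable_fun setT (fun y => delta x y).
  exact: (measurable_fun_pair2 x (rq_measurable Q)).
by have := m1 measurableT _ (measurable_itv `]-oo, 0%R]);
  rewrite preimage_itvNyc; apply.
Qed.

(* No point has positive mass, so the junk value 0^-1 = 0 of the kernel on the
   diagonal is harmless. *)
Let degenerate0 x : mu (degenerate x) = 0.
Proof.
apply/eqP; rewrite -measure_le0; apply/lee_addgt0Pr => e e0; rewrite add0e.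
have v0 := rq_v_gt0 Q; have g0 := rq_g_gt0 Q.
pose r := ((e / v) `^ g^-1)%R.
have r0 : (0 < r)%R by rewrite powR_gt0// divr_gt0.
apply: (@le_trans _ _ (mu [set y | (delta x y < r)%R])).
  apply: le_measure; rewrite ?inE//; first exact: (measurable_rq_ball Q).
  by move=> y /= /le_lt_trans; apply.
rewrite (rq_ball Q)// /r -powRrM mulVf ?gt_eqF// powRr1 ?divr_ge0 ?(ltW e0) ?(ltW v0)//.
by rewrite mulrCA divff ?mulr1// gt_eqF.
Qed.

(** On B(x,t) the kernel is at least t^{-(g-a)}, except at points with delta x y = 0, where it takes
    the value 0; these form a null set. *)
Lemma maximal_le_riesz (a : R) (h : T -> \bar R) x : (a < g)%R ->
  measurable_fun setT h -> (forall y, 0 <= h y) ->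
  maximal mu delta (g - a) h x <= riesz mu delta g a h x.
Proof.
move=> ag mh h0; apply: ge_ereal_sup => z [t /=]; rewrite in_itv/= andbT => t0 <-{z}.
rewrite /ball_mass /riesz integral_mkcond -ge0_integralZl//; last 3 first.
- exact: (measurable_restrictT _ (measurable_rq_ball Q x t)).1 (measurable_funTS mh).
- by move=> y _; exact: erestrict_ge0.
- by rewrite lee_fin powR_ge0.
apply: ae_ge0_le_lower_integral => [y _|y _|].
- by rewrite mule_ge0 ?lee_fin ?powR_ge0//; exact: erestrict_ge0.
- by rewrite mule_ge0// lee_fin invr_ge0 powR_ge0.
exists (degenerate x); split; [exact: measurable_degenerate|exact: degenerate0|].
move=> y /= Hy; rewrite /degenerate/= leNgt; apply/negP => xy; apply: Hy => _.
rewrite patchE; case: ifPn => [/set_mem/= xyt|_]; last first.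
  by rewrite mule0 mule_ge0// lee_fin invr_ge0 powR_ge0.
rewrite muleC; apply: lee_wpmul2l => //; rewrite lee_fin powRN.
rewrite lef_pV2 ?posrE ?powR_gt0//.
by apply: ge0_ler_powR; rewrite ?nnegrE ?subr_ge0 ?ltW.
Qed.

End maximal_riesz.

(** * Lebesgue measure and ellipsoids *)

Section measure_preserving.
Context d (T : measurableType d) (R : realType) (mu : {measure set T -> \bar R}).
Local Open Scope ereal_scope.

Lemma ge0_integral_measure_preserving (f : T -> T) (h : T -> \bar R) :
  measurable_fun setT f ->
  (forall A, measurable A -> mu (f @^-1` A) = mu A) ->
  measurable_fun setT h -> (forall x, 0 <= h x) ->
  \int[mu]_x h (f x) = \int[mu]_x h x.
Proof.
move=> mf fmu mh h0.
have := @ge0_integral_pushforward _ _ _ _ _ f mf mu setT h measurableT mh _.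
rewrite preimage_setT => <-//.
by apply: eq_measure_integral => A mA _; rewrite -(fmu A mA).
Qed.

End measure_preserving.

Lemma lebesgue_measure_translation {R : realType} (c : R) (A : set (measurableTypeR R)) :
  measurable A -> lebesgue_measure [set x : R | A (x + c)] = lebesgue_measure A.
Proof.
move=> mA.
have mf : measurable_fun setT (fun x : measurableTypeR R => (x + c : measurableTypeR R)).
  by apply: measurable_funD.
pose F : {mfun measurableTypeR R >-> measurableTypeR R} :=
  HB.pack (fun x : measurableTypeR R => (x + c : measurableTypeR R))
    (isMeasurableFun.Build _ _ _ _ _ mf).
rewrite [RHS](@lebesgue_measure_unique R (pushforward lebesgue_measure F))//.
move=> X [[a b] /= ab <-]; rewrite /pushforward.
rewrite (_ : _ @^-1` _ = `]a - c, b - c]%classic); last first.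
  by apply/seteqP; split => x /=; rewrite !in_itv/= ltrBlDr lerBrDr.
rewrite !lebesgue_measure_itv/= !lte_fin ltrD2r; case: ifP => // _.
by rewrite -!EFinB; congr EFin; ring.
Qed.

Section lebesgue_cV_facts.
Context {R : realType}.
Local Open Scope ereal_scope.

Lemma measurable_fun_cV d (T : measurableType d) n (f : T -> 'cV[R]_n) :
  (forall i, measurable_fun setT (fun t => f t i 0%R)) -> measurable_fun setT f.
Proof.
move=> mf _ Y mY; rewrite setTI.
have : (g_sigma_preimage (fun i (x : 'cV[R]_n) => x i 0%R) : set (set _)) `<=`
    [set A | measurable (f @^-1` A)].
  apply: smallest_sub.
    split => [|A mA|F mF] /=.
    - by rewrite preimage_set0.
    - by rewrite setTD -preimage_setC; exact: measurableC.
    - by rewrite preimage_bigcup; exact: bigcupT_measurable.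
  case: n f mf Y mY => [|n] f mf Y mY.
    by rewrite big_ord0.
  rewrite -bigcup_mkord_ord; apply: bigcup_sub => i Ii A [B mB <-] /=.
  rewrite setTI -comp_preimage -[X in measurable X]setTI.
  exact: mf.
exact.
Qed.

Definition cube n (m : R) : set 'cV[R]_n := [set x | forall i, (`|x i 0| <= m)%R].

Lemma measurable_cube n m : measurable (@cube n m).
Proof.
rewrite (_ : @cube n m = ~` \bigcup_(i in [set: 'I_n]) [set x : 'cV[R]_n | (m < `|x i 0|)%R]).
  apply: measurableC; apply: fin_bigcup_measurable => [|i _]; first exact: finite_finset.
  rewrite -[X in measurable X]setTI.
  have mi : measurable_fun setT (fun x : 'cV[R]_n => `|x i 0|%R).
    by apply: measurableT_comp => //; exact: measurable_cV_coord.
  by have := mi measurableT _ (measurable_itv `]m, +oo[); rewrite preimage_itvoy; apply.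
apply/seteqP; split => [x xm [i _ /=]|x xm i]; first by rewrite ltNge xm.
by rewrite leNgt; apply/negP => mi; apply: xm; exists i.
Qed.

Lemma lebesgue_cV_cube n (m : R) : (0 <= m)%R ->
  lebesgue_cV n (@cube n m) = ((2 * m) ^+ n)%:E.
Proof.
move=> m0; elim: n => [|n IH] /=.
  by rewrite diracE expr0 mem_set// => -[].
rewrite /lebesgue_cV_step /pushforward.
have -> : @cV_cons R n @^-1` @cube n.+1 m = @cube n m `*` `[(- m)%R, m]%classic.
  apply/seteqP; split => [[x t] /= xt|[x t] /= [xm tm] i].
    split=> [i|/=].
      by have := xt (lift ord0 i); rewrite mxE liftK.
    by have := xt ord0; rewrite mxE unlift_none/= in_itv/= ler_norml.
  rewrite mxE; case: unliftP => [j _|_] /=; first exact: xm.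
  by move: tm; rewrite in_itv/= ler_norml.
transitivity (lebesgue_cV n (@cube n m) * lebesgue_measure `[(- m)%R, m]%classic).
  by apply: product_measure1E => //; exact: measurable_cube.
rewrite IH lebesgue_measure_itv/= lte_fin; case: ifPn => [_|].
  by rewrite -EFinB -EFinM exprSr; congr (_ * _)%:E; ring.
rewrite -leNgt => mm; have -> : m = 0%R by apply/eqP; rewrite eq_le m0 andbT; lra.
by rewrite mulr0 exprS mul0r mule0.
Qed.

Lemma lebesgue_cV_sigma_finite n : sigma_finite setT (@lebesgue_cV R n).
Proof.
exists (fun m => @cube n m%:R).
  apply/esym/seteqP; split => // x _.
  exists (Num.truncn (\sum_i `|x i 0|)%R).+1 => // i.
  rewrite (le_trans _ (ltW (truncnS_gt _)))// (bigD1 i)//= lerDl.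
  by apply: sumr_ge0.
move=> m; split; first exact: measurable_cube.
by rewrite lebesgue_cV_cube ?ltry.
Qed.

(** Induction on the dimension: a section of the translated set is a one-dimensional translate of
    the section of A over the translated base point, so invariance on the line handles the fibres
    and the induction hypothesis the base. *)
Lemma lebesgue_cV_translation n (c : 'cV[R]_n) (A : set 'cV[R]_n) : measurable A ->
  lebesgue_cV n [set x | A (x + c)%R] = lebesgue_cV n A.
Proof.
elim: n c A => [|n IH] c A mA.
  congr (lebesgue_cV 0 _); apply/seteqP; split => x /=;
    by rewrite (_ : x + c = x)%R//; apply/colP => -[].
pose c' := (\col_j c (lift ord0 j) 0 : 'cV[R]_n)%R.
have mpre B : measurable B -> measurable (@cV_cons R n @^-1` B).
  by move=> mB; rewrite -[X in measurable X]setTI; exact: measurable_cV_cons.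
have mt m (e : 'cV[R]_m) : measurable_fun setT (fun x : 'cV[R]_m => (x + e)%R).
  apply: measurable_fun_cV => i; under eq_fun do rewrite mxE.
  by apply: measurable_funD => //; exact: measurable_cV_coord.
pose G x := lebesgue_measure (xsection (@cV_cons R n @^-1` A) x).
have mG : measurable_fun setT G.
  exact: (@measurable_fun_xsection _ _ _ _ R lebesgue_measure _ (mpre _ mA)).
rewrite /= /lebesgue_cV_step /pushforward /product_measure1.
rewrite -[RHS](@ge0_integral_measure_preserving _ _ _ (lebesgue_cV n)
  (fun x : 'cV[R]_n => (x + c')%R) G)//; last 2 first.
- exact: mt.
- by move=> B mB; exact: IH.
apply: eq_integral => x _; rewrite /G/=.
rewrite -[RHS](lebesgue_measure_translation (c ord0 0%R)); last first.
  exact: measurable_xsection (mpre _ mA).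
congr (lebesgue_measure _); apply/seteqP.
have E t : cV_cons ((x + c')%R, (t + c ord0 0%R)%R) = (cV_cons (x, t) + c)%R.
  apply/colP => i; rewrite !mxE; case: unliftP => [j ->|->] //=; by rewrite !mxE.
by split => t /=; rewrite !xsectionE/= ?E.
Qed.

End lebesgue_cV_facts.

(** The proof is closed transparently: the packed measure must remain convertible to m, so that
    statements about [lebesgue_cV_sf] apply to [lebesgue_cV]. *)
Definition sigma_finite_pack d (T : measurableType d) (R : realType)
  (m : {measure set T -> \bar R}) (h : sigma_finite setT m) :
  {sigma_finite_measure set T -> \bar R}.
Proof.
pose H1 := isSFinite.Build _ _ _ m (sfinite_measure_sigma_finite h).
pose H2 := isSigmaFinite.Build _ _ _ m h.
exact (HB.pack_for (SigmaFiniteMeasure.type T R) (Measure.sort m) H1 H2).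
Defined.

Definition lebesgue_cV_sf {R : realType} n : {sigma_finite_measure set 'cV[R]_n -> \bar R} :=
  sigma_finite_pack (@lebesgue_cV_sigma_finite R n).

(** * Volume and boundedness properties of the quasi-distance *)

Section quasi_distance_facts.
Context {R : realType} (n : nat) (P : 'M[R]_n) (rho : 'cV[R]_n -> R).
Context (hrho : quasi_distance P rho) (g0 : 0 < \tr P).
Local Open Scope ereal_scope.
Notation V := 'cV[R]_n.
Notation g := (\tr P).
Notation mu := (lebesgue_cV n).

Let delta (x y : V) := rho (x - y)%R.

Let mrho_lt r : measurable [set x | (rho x < r)%R].
Proof.
rewrite -[X in measurable X]setTI.
by have := quasi_distance_measurable hrho measurableT (measurable_itv `]-oo, r[);
  rewrite preimage_itvNyo; apply.
Qed.

Let sphere := [set w | rho w = 1%R].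

Let measurable_sphere : measurable sphere.
Proof.
rewrite -[X in measurable X]setTI.
exact: (quasi_distance_measurable hrho measurableT (measurable_set1 1%R)).
Qed.

(** The polar decomposition is applied to the indicator of the ball. As rho (t^P w) = t on the unit
    sphere, the inner integral is sigma(sphere) for t < r and 0 otherwise, so v = sigma(sphere) / tr
    P. *)
Lemma rho_ball_measure : exists2 v : R, (0 < v)%R &
  forall r, (0 < r)%R -> mu [set x | (rho x < r)%R] = (v * r `^ g)%:E.
Proof.
have [sigma _ polar] := quasi_distance_polar hrho.
have sfin : sigma sphere \is a fin_num by exact: fin_num_measure.
pose s := fine (sigma sphere).
have int1 : \int[sigma]_(w in sphere) (cst 1 w : \bar R) = s%:E.
  by rewrite integral_cst ?mul1e ?fineK//; exact: measurable_sphere.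
have s_ge0 : (0 <= s)%R by rewrite fine_ge0.
(* A null sphere would make the whole space null, again by the polar decomposition, but the unit
   cube has positive measure. *)
have s0 : (0 < s)%R.
  rewrite lt_neqAle s_ge0 andbT; apply/eqP => s0.
  have := polar (cst 1) (measurable_cst _) (fun=> lee01).
  rewrite integral_cst// mul1e [RHS]integral0_eq; last first.
    by move=> r _; have /= -> := int1; rewrite -s0 mule0.
  move=> mu0; have : mu (@cube R n 1) <= mu setT.
    by apply: le_measure; rewrite ?inE//; exact: measurable_cube.
  by rewrite mu0 lebesgue_cV_cube// lee_fin leNgt mulr1 exprn_gt0.
exists (s / g)%R; first by rewrite divr_gt0.
move=> r r0.
pose f (x : V) : \bar R := (\1_[set x | (rho x < r)%R] x)%:E.
have mf : measurable_fun setT f by apply/measurable_EFinP/measurable_indic.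
have f0 x : 0 <= f x by rewrite lee_fin.
have := polar f mf f0; rewrite /f integral_indic// setIT => ->.
transitivity ((s / g)%:E * \int[lebesgue_measure]_(t in `]0%R, r[) (g * t `^ (g - 1))%:E);
  last by rewrite integral_powR_head// -EFinM.
rewrite -ge0_integralZl//; last 3 first.
- by apply: measurable_funTS; exact: measurable_powR_density.
- by move=> t _; rewrite lee_fin mulr_ge0 ?powR_ge0// ltW.
- by rewrite lee_fin divr_ge0// ltW.
rewrite [LHS]integral_mkcond [RHS]integral_mkcond; apply: eq_integral => t _.
rewrite !patchE !mem_setE !in_itv/= andbT.
have [t0/=|//] := ltP 0%R t.
have E w : sphere w -> rho (mxpow t P *m w)%R = t.
  by move=> w1; rewrite (quasi_distance_homogeneous hrho)// w1 mulr1.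
have [tr|rt] := ltP t r.
  rewrite (eq_integral (cst 1)); last first.
    by move=> w /set_mem w1; rewrite indicE mem_set//= E.
  have /= -> := int1; rewrite -!EFinM; congr EFin.
  by field; rewrite gt_eqF.
rewrite integral0_eq ?mule0// => w w1.
by rewrite indicE memNset//= E//; apply/negP; rewrite -leNgt.
Qed.

Lemma measurable_delta : measurable_fun setT (fun z : V * V => delta z.1 z.2).
Proof.
apply: (@measurableT_comp _ _ _ _ _ _ rho); first exact: (quasi_distance_measurable hrho).
apply: measurable_fun_cV => i; under eq_fun do rewrite mxE mxE.
apply: measurable_funB.
  apply: (@measurableT_comp _ _ _ _ _ _ (fun x : V => x i 0%R)) => //.
  exact: measurable_cV_coord.
apply: (@measurableT_comp _ _ _ _ _ _ (fun x : V => x i 0%R)) => //.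
exact: measurable_cV_coord.
Qed.

Lemma quasi_distance_regular : exists k v,
  regular_quasimetric (@lebesgue_cV_sf R n) delta k v g.
Proof.
have [k ktri] := quasi_distance_triangle hrho.
have [v v0 vE] := rho_ball_measure.
(* Enlarging k to at least 1 preserves the triangle inequality and makes 2kr larger than r. *)
exists (Num.max k 1%R), v; split => //.
- exact: measurable_delta.
- by move=> x y; exact: (quasi_distance_ge0 hrho).
- by move=> x y; exact: (quasi_distanceC hrho).
- move=> x y z; apply: (le_trans (ktri x y z)); apply: ler_wpM2r.
    by rewrite addr_ge0// (quasi_distance_ge0 hrho).
  by rewrite le_max lexx.
- by rewrite le_max lexx orbT.
move=> x r r0; rewrite -vE// -(lebesgue_cV_translation (- x)%R)//=.
by congr (lebesgue_cV n _); apply/seteqP; split => y /=; rewrite /delta (quasi_distanceC hrho).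
Qed.

(* rho is not assumed continuous. For N large most y in the cube satisfy both
   rho y < N and rho (y + x) < N, and rho x is controlled by these two values. *)
Lemma rho_bounded_cube (m : R) : (0 < m)%R ->
  exists M, forall x, @cube R n m x -> (rho x < M)%R.
Proof.
move=> m0; have [k ktri] := quasi_distance_triangle hrho.
(* The cube is doubled so that it contains y + x whenever y and x lie in the original one. These
   sets decrease to the empty set, so one of them has less than half the measure of the original
   cube. *)
pose U (N : nat) := @cube R n (2 * m) `&` ~` [set x | (rho x < N%:R)%R].
have mU N : measurable (U N).
  by apply: measurableI; [exact: measurable_cube|exact: measurableC].
have mQ : measurable (@cube R n m) by exact: measurable_cube.
have m20 : (0 <= 2 * m)%R by rewrite mulr_ge0// ltW.
pose c := ((2 * m) ^+ n)%R.
have c0 : (0 < c)%R by rewrite exprn_gt0// mulr_gt0.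
have muQ : mu (@cube R n m) = c%:E by rewrite lebesgue_cV_cube// ltW.
have [N UN] : exists N, mu (U N) < (c / 2)%:E.
  apply: contrapT => noN.
  have cU : mu \o U @ \oo --> mu (\bigcap_N U N).
    apply: nonincreasing_cvg_mu => //.
    - apply: (@le_lt_trans _ _ (mu (@cube R n (2 * m)))); last first.
        by rewrite lebesgue_cV_cube// ltry.
      by apply: le_measure; rewrite ?inE; [exact: mU|exact: measurable_cube|move=> x []].
    - exact: bigcapT_measurable.
    - move=> i j ij; apply/subsetPset => x [xQ /= xj]; split => //=.
      by apply: contra_not xj => /lt_le_trans; apply; rewrite ler_nat.
  have cap0 : \bigcap_N U N = set0.
    apply/seteqP; split => // x /(_ (Num.truncn (rho x)).+1 I)[_ /=].
    by apply; exact: truncnS_gt.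
  have : (c / 2)%:E <= limn (mu \o U).
    apply: lime_ge; first by apply/cvg_ex; eexists; exact: cU.
    by apply: nearW => N /=; rewrite leNgt; apply/negP => H; apply: noN; exists N.
  rewrite (cvg_lim _ cU)// cap0 measure0 lee_fin leNgt => /negP; apply.
  by rewrite divr_gt0.
exists (Num.max k 1%R * (N%:R + N%:R))%R => x xm.
(* Otherwise [U N] and its translate by -x would cover the cube, yet their measures add up to less
   than that of the cube. *)
have [y [ym yN xyN]] : exists y, [/\ @cube R n m y, (rho y < N%:R)%R & (rho (y + x) < N%:R)%R].
  apply: contrapT => noy.
  have : mu (@cube R n m) <= mu (U N `|` [set y | U N (y + x)%R]).
    have mx : measurable [set y | U N (y + x)%R].
      have mt : measurable_fun setT (fun y : V => (y + x)%R).
        apply: measurable_fun_cV => i; under eq_fun do rewrite mxE.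
        by apply: measurable_funD => //; exact: measurable_cV_coord.
      by rewrite -[X in measurable X]setTI; exact: mt.
    apply: le_measure; rewrite ?inE//; first exact: measurableU.
    move=> y ym; have [yN|yN] := boolP (rho y < N%:R)%R.
      right; split => [i|/= xyN]; last by apply: noy; exists y.
      rewrite mxE (le_trans (ler_normD _ _))// (le_trans (lerD (ym i) (xm i)))//.
      by rewrite -mulr2n mulr_natl.
    left; split => [i|/=]; last exact/negP.
    by apply: (le_trans (ym i)); lra.
  apply/negP; rewrite -ltNge muQ.
  apply: (@le_lt_trans _ _ (mu (U N) + mu (U N))).
    rewrite -[X in _ <= _ + X](lebesgue_cV_translation x)//.
    apply: measureU2 => //.
    have mt : measurable_fun setT (fun y : V => (y + x)%R).
      apply: measurable_fun_cV => i; under eq_fun do rewrite mxE.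
      by apply: measurable_funD => //; exact: measurable_cV_coord.
    by rewrite -[X in measurable X]setTI; exact: mt.
  have -> : c%:E = (c / 2)%:E + (c / 2)%:E by rewrite -EFinD -splitr.
  exact: lteD.
have := ktri (y + x)%R y 0%R; rewrite addrAC subrr add0r !subr0 => /le_lt_trans; apply.
have k1 : (0 < Num.max k 1)%R by rewrite lt_max ltr01 orbT.
apply: (@le_lt_trans _ _ (Num.max k 1%R * (rho (y + x)%R + rho y))%R).
  apply: ler_wpM2r; last by rewrite le_max lexx.
  by rewrite addr_ge0// (quasi_distance_ge0 hrho).
by rewrite ltr_pM2l// ltrD.
Qed.

(** Reduces the condition on compact sets in the definition of the Morrey spaces to an estimate on a
    single ellipsoid. *)
Lemma compact_ellipsoid (K : set V) : compact K ->
  exists2 r, (0 < r)%R & K `<=` ellipsoid rho 0%R r.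
Proof.
move=> /compact_bounded[M [_ KM]].
pose m := Num.max (M + 1)%R 1%R.
have m0 : (0 < m)%R by rewrite lt_max ltr01 orbT.
have [M' HM'] := rho_bounded_cube m0.
exists (Num.max M' 1%R); first by rewrite lt_max ltr01 orbT.
move=> x Kx; rewrite /ellipsoid/= (quasi_distanceC hrho) subr0 lt_max HM'// => i.
have : (`|x| <= m)%R by apply: KM => //; rewrite lt_max ltrDl ltr01.
apply: le_trans; rewrite [leRHS]/Num.norm/= mx_normrE.
by apply: (le_bigmax_cond _ (fun ij => `|x ij.1 ij.2|%R) (j := (i, 0%R))).
Qed.

End quasi_distance_facts.

(** * The operators on Morrey spaces *)

Section assembly.
Context {R : realType} (n : nat) (P : 'M[R]_n) (rho : 'cV[R]_n -> R).
Context (hrho : quasi_distance P rho).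
Local Open Scope ereal_scope.
Notation V := 'cV[R]_n.
Notation g := (\tr P).
Notation mu := (@lebesgue_cV R n).
Notation delta := (fun x y : V => rho (x - y)%R).
Context (k v : R) (Q : regular_quasimetric (@lebesgue_cV_sf R n) delta k v g).

Let v0 : (0 < v)%R. Proof. exact: (rq_v_gt0 Q). Qed.
Let g0 : (0 < g)%R. Proof. exact: (rq_g_gt0 Q). Qed.

Let vrg0 (r : R) : (0 < r)%R -> (0 < v * r `^ g)%R.
Proof. by move=> r0; rewrite mulr_gt0// powR_gt0. Qed.

Let muE x (r : R) : (0 < r)%R -> mu (ellipsoid rho x r) = (v * r `^ g)%:E.
Proof. exact: (rq_ball Q). Qed.

Lemma Lp_normE (p : R) D (f : V -> \bar R) : (0 < p)%R ->
  Lp_norm p D f = (\int[mu]_(y in D) `|f y| `^ p) `^ p^-1.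
Proof.
move=> p0; rewrite /Lp_norm unlock; congr (_ `^ _).
rewrite [RHS]integral_mkcond; apply: eq_integral => y _; rewrite !patchE.
by case: ifPn => // _; rewrite abse0 poweR0r// gt_eqF.
Qed.

Lemma le_Lp_norm (p : R) D E (f : V -> \bar R) : (0 < p)%R -> D `<=` E ->
  Lp_norm p D f <= Lp_norm p E f.
Proof.
move=> p0 DE; rewrite !Lp_normE//.
apply: gt0_ler_poweR; rewrite ?in_itv/= ?leey ?andbT ?invr_ge0 ?(ltW p0)//;
  try by apply: integral_ge0 => y _; exact: poweR_ge0.
rewrite integral_mkcond [leRHS]integral_mkcond; apply: ge0_le_lower_integral => y _.
  by apply: erestrict_ge0 => z _; exact: poweR_ge0.
rewrite !patchE; case: ifPn => [/set_mem/DE/mem_set ->//|_].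
by case: ifPn => // _; exact: poweR_ge0.
Qed.

Lemma le_WLp_norm (p : R) D E (f : V -> \bar R) : (0 < p)%R -> D `<=` E ->
  WLp_norm p D f <= WLp_norm p E f.
Proof.
move=> p0 DE; apply: ge_ereal_sup => z [t]; rewrite /= in_itv/= andbT => t0 <-{z}.
apply: le_ereal_sup_tmp.
exists (t%:E * (\int[mu]_(y in E) (\1_(superlevel f t) y)%:E) `^ p^-1).
  by exists t => //; rewrite /= in_itv/= t0.
apply: lee_wpmul2l; first by rewrite lee_fin ltW.
apply: gt0_ler_poweR; rewrite ?in_itv/= ?leey ?andbT ?invr_ge0 ?(ltW p0)//;
  try by apply: integral_ge0 => y _; rewrite lee_fin.
rewrite integral_mkcond [leRHS]integral_mkcond; apply: ge0_le_lower_integral => y _.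
  by apply: erestrict_ge0 => z _; rewrite lee_fin.
rewrite !patchE; case: ifPn => [/set_mem/DE/mem_set ->//|_].
by case: ifPn => // _; rewrite lee_fin.
Qed.

Section norms.
Context (p q : R) (p0 : (0 < p)%R).
Context (phi : V -> R -> R) (phi_gt0 : forall x t, (0 < t)%R -> (0 < phi x t)%R).
Context (psi : V -> R -> R)
  (psiE : forall x t, (0 < t)%R -> psi x t = (phi x t `^ p^-1)%R).

Let scale x (r : R) := ((phi x r * (v * r `^ g)) `^ q^-1)%R.

Let scale_gt0 x r : (0 < r)%R -> (0 < scale x r)%R.
Proof. by move=> r0; rewrite powR_gt0// mulr_gt0 ?phi_gt0 ?vrg0. Qed.

Lemma morrey_norm_ball (f : V -> \bar R) (N : R) x r : (0 < N)%R -> (0 < r)%R ->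
  M_norm rho p psi f <= N%:E ->
  \int[mu]_(y in ellipsoid rho x r) `|f y| `^ p <=
    (N `^ p * (phi x r * (v * r `^ g)))%:E.
Proof.
move=> N0 r0 fN; have phi0 := phi_gt0 x r0.
set X := (leLHS).
have X0 : 0 <= X by apply: integral_ge0 => y _; exact: poweR_ge0.
have vr := vrg0 r0.
have : (phi x r `^ p^-1)^-1%:E * mu (ellipsoid rho x r) `^ (- p^-1)%R *
    Lp_norm p (ellipsoid rho x r) f <= N%:E.
  apply: le_trans fN; apply: ereal_sup_ubound; exists (x, r) => /=.
    by rewrite in_itv/= r0.
  by rewrite psiE.
rewrite Lp_normE// -/X muE// poweR_EFin powRN -EFinM -invfM -powRM ?(ltW phi0) ?(ltW vr)//.
have s0 : (0 < (phi x r * (v * r `^ g)) `^ p^-1)%R by rewrite powR_gt0// mulr_gt0.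
rewrite lee_pdivrMl// => XN.
have -> : X = (X `^ p^-1) `^ p by rewrite -poweRrM mulVf ?poweRe1// gt_eqF.
have -> : (N `^ p * (phi x r * (v * r `^ g)))%:E =
   (((phi x r * (v * r `^ g)) `^ p^-1)%:E * N%:E) `^ p.
  rewrite -EFinM poweR_EFin (powRM _ (ltW s0) (ltW N0)) -powRrM mulVf ?gt_eqF//.
  by rewrite powRr1 1?mulrC// mulr_ge0// ltW.
by apply: gt0_ler_poweR; rewrite ?in_itv/= ?leey ?andbT ?poweR_ge0 ?(ltW p0)//
  -EFinM lee_fin mulr_ge0// ltW.
Qed.

(** The hypothesis is wanted only for positive N above the norm: N = norm + e with e tending to 0
    covers functions of norm zero as well. The same estimate on an ellipsoid containing K gives the
    local condition. *)
Lemma bounded_operator_ball (T : (V -> \bar R) -> V -> \bar R)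
    (NN : set V -> (V -> \bar R) -> \bar R) (c : R) :
  (0 <= c)%R ->
  (forall D E f, D `<=` E -> NN D f <= NN E f) ->
  (forall f, M_space rho p psi f ->
     completed_measurable_fun mu setT (T f) /\
     forall N x r, (0 < N)%R -> (0 < r)%R -> M_norm rho p psi f <= N%:E ->
       NN (ellipsoid rho x r) (T f) <=
       (c * N * (phi x r * (v * r `^ g)) `^ q^-1)%:E) ->
  bounded_operator T (M_space rho p psi) (M_norm rho p psi)
    (morrey rho NN q (fun x t => phi x t `^ q^-1)%R)
    (morrey_norm rho NN q (fun x t => phi x t `^ q^-1)%R).
Proof.
move=> c0 NNmono HT; exists c => f Xf; have [mTf bTf] := HT f Xf.
have [_ _ foo] := Xf.
have norm0 : 0 <= M_norm rho p psi f.
  apply: le_ereal_sup_tmp; eexists; first by exists (0%R, 1%R) => //=; rewrite in_itv/= ltr01.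
  rewrite !mule_ge0 ?poweR_ge0 ?Lnorm_ge0//= lee_fin invr_ge0 psiE ?powR_ge0//.
have ffin : M_norm rho p psi f \is a fin_num by rewrite ge0_fin_numE.
have key (e : R) : (0 < e)%R ->
    morrey_norm rho NN q (fun x t => phi x t `^ q^-1)%R (T f) <=
    c%:E * (M_norm rho p psi f + e%:E).
  move=> e0; pose N := (fine (M_norm rho p psi f) + e)%R.
  have N0 : (0 < N)%R by rewrite ltr_wpDl// fine_ge0.
  have fN : M_norm rho p psi f <= N%:E by rewrite EFinD fineK// leeDl// lee_fin ltW.
  have -> : M_norm rho p psi f + e%:E = N%:E by rewrite EFinD fineK.
  apply: ge_ereal_sup => z [[x r] /= [_]]; rewrite in_itv/= andbT => r0 <-{z}.
  have phi0 := phi_gt0 x r0; have vr := vrg0 r0.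
  rewrite muE// poweR_EFin powRN -EFinM -invfM -powRM ?(ltW phi0) ?(ltW vr)//.
  by rewrite lee_pdivrMl ?scale_gt0// -!EFinM mulrC; exact: bTf.
have bnd : morrey_norm rho NN q (fun x t => phi x t `^ q^-1)%R (T f) <=
    c%:E * M_norm rho p psi f.
  apply/lee_addgt0Pr => e e0.
  have c10 : (0 < c + 1)%R by rewrite ltr_wpDl.
  (* This choice keeps the error c e / (c + 1) below e, also when c = 0. *)
  apply: (le_trans (key (e / (c + 1))%R _)); first by rewrite divr_gt0.
  rewrite -(fineK ffin) -EFinD -!EFinM -EFinD lee_fin mulrDr lerD2l mulrCA.
  by rewrite ler_piMr ?(ltW e0)// ler_pdivrMr// mul1r lerDl.
split; last exact: bnd.
split => //; last first.
  by apply: le_lt_trans bnd _; rewrite -(fineK ffin) -EFinM ltry.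
move=> K /(compact_ellipsoid hrho)[r r0 Kr].
apply: (le_lt_trans (NNmono _ _ _ Kr)).
pose N := (fine (M_norm rho p psi f) + 1)%R.
have N0 : (0 < N)%R by rewrite ltr_wpDl// fine_ge0.
have fN : M_norm rho p psi f <= N%:E by rewrite EFinD fineK// leeDl// lee_fin.
by apply: le_lt_trans (bTf N 0%R r N0 r0 fN) _; rewrite ltry.
Qed.

End norms.
End assembly.

(** * Operators dominated by the Riesz potential *)

Section operators.
Context {R : realType} (n : nat) (P : 'M[R]_n) (rho : 'cV[R]_n -> R).
Context (hrho : quasi_distance P rho).
Local Open Scope ereal_scope.
Notation V := 'cV[R]_n.
Notation g := (\tr P).
Notation mu := (@lebesgue_cV R n).
Notation delta := (fun x y : V => rho (x - y)%R).
Context (k v : R) (Q : regular_quasimetric (@lebesgue_cV_sf R n) delta k v g).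
Context (p q a C : R) (p1 : (1 <= p)%R) (pq : (p < q)%R) (a0 : (0 < a)%R) (ag : (a < g)%R).
Context (C0 : (0 < C)%R).
Context (phi : V -> R -> R) (phi_gt0 : forall x t, (0 < t)%R -> (0 < phi x t)%R).
Context (phi_sup : forall x r, (0 < r)%R ->
  ereal_sup [set (t `^ (- g))%:E *
                 ess_inf (mrestr lebesgue_measure (measurable_itv `]t, +oo[))
                   (fun tau : R => (phi x tau * tau `^ g)%:E)
               | t in `]r, +oo[] <= (C * phi x r)%:E).
Context (phi_int : forall x r, (0 < r)%R ->
  \int[lebesgue_measure]_(t in `]r, +oo[) (t `^ a * phi x t `^ p^-1 / t)%:E
    <= (C * r `^ (- (a * p / (q - p))))%:E).
Context (psi : V -> R -> R)
  (psiE : forall x t, (0 < t)%R -> psi x t = (phi x t `^ p^-1)%R).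

Let p0 : (0 < p)%R. Proof. exact: lt_le_trans p1. Qed.
Let q0 : (0 < q)%R. Proof. exact: lt_trans pq. Qed.
Let v0 : (0 < v)%R. Proof. exact: (rq_v_gt0 Q). Qed.
Let g0 : (0 < g)%R. Proof. exact: (rq_g_gt0 Q). Qed.

Section dominated.
Context (T : (V -> \bar R) -> V -> \bar R) (c : R) (c0 : (0 < c)%R).
Context (Tae : forall f f', {ae mu, forall x, setT x -> f x = f' x} -> T f = T f').
Context (mT : forall f, measurable_fun setT f -> measurable_fun setT (T f)).
Context (leT : forall f x, measurable_fun setT f ->
  `|T f x| <= c%:E * riesz (@lebesgue_cV_sf R n) delta g a (abse \o f) x).

(** By [Tae], passing to a Borel representative f' does not change T f at any point, so the Borel
    estimates apply to T f itself. *)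
Let representative f : M_space rho p psi f -> exists f',
  [/\ measurable_fun setT f', T f = T f' &
    forall N : R, (0 < N)%R -> M_norm rho p psi f <= N%:E ->
      morrey_bounded (@lebesgue_cV_sf R n) delta v g p phi (abse \o f') N].
Proof.
move=> [[f' mf' ff'] _ _]; exists f'; split => //; first exact: Tae.
move=> N N0 fN x t t0.
have := morrey_norm_ball Q p0 phi_gt0 psiE x N0 t0 fN; apply: le_trans.
rewrite le_eqVlt; apply/orP; left; apply/eqP.
apply: (@ae_eq_lower_integral _ _ _ mu); apply: filterS ff' => y /(_ I) fy _ /=.
by rewrite fy.
Qed.

Let scaleE (N w s : R) : (0 < N)%R -> (0 <= w)%R -> (0 <= s)%R ->
  ((N `^ q * s * w) `^ q^-1 = N * s `^ q^-1 * w `^ q^-1)%R.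
Proof.
move=> N0 w0 s0; rewrite !powRM ?mulr_ge0 ?powR_ge0// -powRrM mulfV ?gt_eqF//.
by rewrite powRr1// ltW.
Qed.

(** Both operators are treated at once: it suffices that T ignores null sets, preserves
    measurability and is dominated pointwise by c times the potential of |f|. *)
Lemma dominated_strong : (1 < p)%R ->
  bounded_operator T (M_space rho p psi) (M_norm rho p psi)
    (M_space rho q (fun x t => phi x t `^ q^-1)%R)
    (M_norm rho q (fun x t => phi x t `^ q^-1)%R).
Proof.
(* The absolute value makes the constant nonnegative with no need to inspect its sign. *)
move=> p_gt1; pose K : R := `|adams_strong_constant k v g p q a C|%R.
apply: (bounded_operator_ball hrho Q phi_gt0 psiE (NN := Lp_norm q)
  (c := (c * K `^ q^-1)%R)).
- by rewrite mulr_ge0 ?powR_ge0// ltW.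
- by move=> D E f; exact: le_Lp_norm.
move=> f /representative[f' [mf' -> fN]]; split.
  by exists (T f'); [exact: mT|exact: aeW].
move=> N x r N0 r0 /(fN _ N0) hN; rewrite Lp_normE//.
have w0 : (0 <= phi x r * (v * r `^ g))%R by rewrite !mulr_ge0 ?powR_ge0 ?(ltW v0)// ltW// phi_gt0.
have mh : measurable_fun setT (abse \o f') by exact: measurableT_comp.
have h0 (y : V) : 0 <= (abse \o f') y by exact: abse_ge0.
have Jq := adams_strong Q p1 pq a0 ag C0 phi_gt0 phi_sup phi_int x p_gt1 N0 mh h0 hN r0.
have J0 y : 0 <= riesz (@lebesgue_cV_sf R n) delta g a (abse \o f') y by exact: riesz_ge0.
apply: (@le_trans _ _ ((((c * N) `^ q * K * (phi x r * (v * r `^ g)))%:E) `^ q^-1)).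
  apply: gt0_ler_poweR; rewrite ?in_itv/= ?leey ?andbT ?invr_ge0 ?(ltW q0)//.
  - by apply: integral_ge0 => y _; exact: poweR_ge0.
  - by rewrite lee_fin mulr_ge0// mulr_ge0 ?powR_ge0 ?normr_ge0.
  apply: (@le_trans _ _ (\int[mu]_(y in ellipsoid rho x r)
      ((c `^ q)%:E * riesz (@lebesgue_cV_sf R n) delta g a (abse \o f') y `^ q))).
    apply: ge0_le_lower_integral => y _; first exact: poweR_ge0.
    rewrite -poweR_EFin -poweRM ?lee_fin ?(ltW c0)//.
    apply: gt0_ler_poweR; rewrite ?in_itv/= ?leey ?andbT ?(ltW q0)//.
    - by rewrite mule_ge0 ?lee_fin ?(ltW c0).
    - exact: leT.
  rewrite (@ge0_integralZl _ _ _ (lebesgue_cV n)) ?lee_fin ?powR_ge0//; last 3 first.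
  - exact: (measurable_rq_ball Q).
  - by apply: measurable_funTS; apply: measurable_fun_poweR; exact: (measurable_riesz Q).
  - by move=> y _; exact: poweR_ge0.
  apply: (le_trans (lee_wpmul2l _ Jq)); first by rewrite lee_fin powR_ge0.
  have E (x1 x2 x3 x4 : R) : (x1 * x2 * x3 * x4 = x1 * (x2 * x3 * x4))%R by rewrite !mulrA.
  rewrite -EFinM lee_fin (powRM _ (ltW c0) (ltW N0)) [leRHS]E.
  apply: ler_wpM2l; first exact: powR_ge0.
  apply: ler_wpM2r => //; apply: ler_wpM2l; first exact: powR_ge0.
  exact: ler_norm.
rewrite poweR_EFin scaleE ?mulr_gt0//; last by rewrite /K.
by rewrite lee_fin le_eqVlt; apply/orP; left; apply/eqP; ring.
Qed.

Lemma dominated_weak : p = 1%R ->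
  bounded_operator T (M_space rho p psi) (M_norm rho p psi)
    (WM_space rho q (fun x t => phi x t `^ q^-1)%R)
    (WM_norm rho q (fun x t => phi x t `^ q^-1)%R).
Proof.
move=> pE; pose K : R := `|adams_weak_constant k v g q a C|%R.
apply: (bounded_operator_ball hrho Q phi_gt0 psiE (NN := WLp_norm q)
  (c := (c * K `^ q^-1)%R)).
- by rewrite mulr_ge0 ?powR_ge0// ltW.
- by move=> D E f; exact: le_WLp_norm.
move=> f /representative[f' [mf' -> fN]]; split.
  by exists (T f'); [exact: mT|exact: aeW].
move=> N x r N0 r0 /(fN _ N0) hN.
have w0 : (0 <= phi x r * (v * r `^ g))%R by rewrite !mulr_ge0 ?powR_ge0 ?(ltW v0)// ltW// phi_gt0.
have mh : measurable_fun setT (abse \o f') by exact: measurableT_comp.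
have h0 (y : V) : 0 <= (abse \o f') y by exact: abse_ge0.
apply: ge_ereal_sup => z [s]; rewrite /= in_itv/= andbT => s0 <-{z}.
(* Where |T f'| > s, the potential of |f'| exceeds s/c, so the weak estimate is used at that
   height. *)
have sc0 : (0 < s / c)%R by rewrite divr_gt0.
have [A [mA EA] muA] :=
  adams_weak Q p1 pq a0 ag C0 phi_gt0 phi_sup phi_int x pE N0 mh h0 hN r0 sc0.
apply: (@le_trans _ _ (s%:E *
    ((((c * N / s) `^ q * K * (phi x r * (v * r `^ g)))%:E) `^ q^-1))).
  apply: lee_wpmul2l; first by rewrite lee_fin ltW.
  apply: gt0_ler_poweR; rewrite ?in_itv/= ?leey ?andbT ?invr_ge0 ?(ltW q0)//.
  - by apply: integral_ge0 => y _; rewrite lee_fin.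
  - by rewrite lee_fin mulr_ge0// mulr_ge0 ?powR_ge0 ?normr_ge0.
  apply: (@le_trans _ _ (mu A)).
    have -> : mu A = \int[mu]_y (\1_A y)%:E by rewrite integral_indic// setIT.
    rewrite [leLHS]integral_mkcond.
    apply: ge0_le_lower_integral => y _.
      by apply: erestrict_ge0 => u _; rewrite lee_fin.
    rewrite patchE; case: ifPn => [/set_mem Ey|_]; last by rewrite lee_fin.
    rewrite !indicE lee_fin ler_nat; case: (boolP (y \in superlevel _ _)) => // /set_mem sy.
    rewrite mem_set//; apply: EA; split => //=.
    rewrite EFinM lte_pdivrMr// muleC.
    by apply: lt_le_trans sy _; exact: leT.
  apply: (le_trans muA); rewrite lee_fin.
  have -> : (N / (s / c) = c * N / s)%R by field; rewrite !gt_eqF.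
  apply: ler_wpM2r => //; apply: ler_wpM2l; first exact: powR_ge0.
  exact: ler_norm.
rewrite poweR_EFin scaleE ?divr_gt0 ?mulr_gt0//; last by rewrite /K.
rewrite -EFinM lee_fin le_eqVlt; apply/orP; left; apply/eqP.
by field; rewrite gt_eqF.
Qed.

End dominated.

Lemma riesz_potential_dominated :
  [/\ forall f f', {ae mu, forall x, setT x -> f x = f' x} ->
        riesz_potential rho g a f = riesz_potential rho g a f',
      forall f, measurable_fun setT f -> measurable_fun setT (riesz_potential rho g a f) &
      forall f x, measurable_fun setT f ->
        `|riesz_potential rho g a f x| <= 1%:E * riesz (@lebesgue_cV_sf R n) delta g a (abse \o f) x].
Proof.
split.
- move=> f f' ff'; apply/funext => x; apply: ae_eq_lower_integral.
  by apply: filterS ff' => y /(_ I) -> _.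
- by move=> f mf; exact: (measurable_riesz Q).
- by move=> f x mf; rewrite mul1e; exact: (le_abse_riesz Q).
Qed.

(** As |E(x,t)| = v t^g, the factor |E(x,t)|^{-1+a/g} is v^{-1+a/g} t^{-(g-a)}. *)
Let frac_maximalE f x : frac_maximal rho g a f x =
  (v `^ (- 1 + a / g))%:E * maximal (@lebesgue_cV_sf R n) delta (g - a) (abse \o f) x.
Proof.
rewrite /frac_maximal /maximal -ereal_sup_pZl ?powR_gt0//; congr ereal_sup.
rewrite image_comp; apply: eq_imagel => t /=.
rewrite in_itv/= andbT => t0.
have -> : mu (ellipsoid rho x t) = (v * t `^ g)%:E by exact: (rq_ball Q).
rewrite poweR_EFin muleA -EFinM.
congr (_%:E * _); rewrite powRM ?powR_ge0 ?(ltW v0)// -powRrM; congr (_ * _ `^ _)%R.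
by field; rewrite gt_eqF.
Qed.

Lemma frac_maximal_dominated :
  [/\ forall f f', {ae mu, forall x, setT x -> f x = f' x} ->
        frac_maximal rho g a f = frac_maximal rho g a f',
      forall f, measurable_fun setT f -> measurable_fun setT (frac_maximal rho g a f) &
      forall f x, measurable_fun setT f ->
        `|frac_maximal rho g a f x| <=
          (v `^ (- 1 + a / g))%:E * riesz (@lebesgue_cV_sf R n) delta g a (abse \o f) x].
Proof.
have ga0 : (0 <= g - a)%R by rewrite subr_ge0 ltW.
have mabs f : measurable_fun setT f -> measurable_fun setT (abse \o f : V -> \bar R).
  by move=> mf; exact: measurableT_comp.
split.
- move=> f f' ff'; apply/funext => x; rewrite !frac_maximalE; congr (_ * ereal_sup _).
  apply: eq_imagel => t _; congr (_ * _).
  apply: ae_eq_lower_integral.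
  by apply: filterS ff' => y /(_ I) /= -> _.
- move=> f mf; rewrite (_ : frac_maximal _ _ _ _ = fun x =>
    (v `^ (- 1 + a / g))%:E * maximal (@lebesgue_cV_sf R n) delta (g - a) (abse \o f) x).
    apply: measurable_funeM.
    exact: (measurable_maximal Q ga0 (mabs _ mf) (fun y => abse_ge0 (f y))).
  by apply/funext => x; exact: frac_maximalE.
- move=> f x mf; rewrite frac_maximalE gee0_abs; last first.
    apply: mule_ge0; first by rewrite lee_fin powR_ge0.
    by apply: maximal_ge0 => y; exact: abse_ge0.
  apply: lee_wpmul2l; first by rewrite lee_fin powR_ge0.
  exact: (maximal_le_riesz Q x ag (mabs _ mf) (fun y => abse_ge0 (f y))).
Qed.

End operators.

Unset Implicit Arguments.

Theorem corollary5 (R : realType) (n : nat) (hn : (2 <= n)%N)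
  (P : 'M[R]_n) (hP : eigenvalues_in_right_half_plane P)
  (rho : 'cV[R]_n -> R) (hrho : quasi_distance P rho)
  (p alpha q C : R) (hp : 1 <= p)
  (halpha : 0 < alpha) (halphap : alpha < \tr P / p) (hpq : p < q)
  (phi : 'cV[R]_n -> R -> R)
  (phi_pos : forall x t, 0 < t -> 0 < phi x t)
  (phi_meas : completed_measurable_fun (product_measure1 (lebesgue_cV n) lebesgue_measure)
     (setT `*` `]0, +oo[) (fun z : 'cV[R]_n * R => phi z.1 z.2))
  (phi_sup : forall x r, 0 < r ->
     (ereal_sup [set (t `^ (- \tr P))%:E *
                     ess_inf (mrestr lebesgue_measure (measurable_itv `]t, +oo[))
                       (fun tau : R => (phi x tau * tau `^ \tr P)%:E)
                   | t in `]r, +oo[] <= (C * phi x r)%:E)%E)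
  (phi_int : forall x r, 0 < r ->
     (\int[lebesgue_measure]_(t in `]r, +oo[)
        (t `^ alpha * phi x t `^ p^-1 / t)%:E
      <= (C * r `^ (- (alpha * p / (q - p))))%:E)%E) :
  let M := frac_maximal rho (\tr P) alpha in
  let I := riesz_potential rho (\tr P) alpha in
  let phi_p := fun x t => phi x t `^ p^-1 in
  let phi_q := fun x t => phi x t `^ q^-1 in
  (1 < p ->
     bounded_operator M (M_space rho p phi_p) (M_norm rho p phi_p)
                        (M_space rho q phi_q) (M_norm rho q phi_q) /\
     bounded_operator I (M_space rho p phi_p) (M_norm rho p phi_p)
                        (M_space rho q phi_q) (M_norm rho q phi_q)) /\
  (p = 1 ->
     bounded_operator M (M_space rho 1 phi) (M_norm rho 1 phi)
                        (WM_space rho q phi_q) (WM_norm rho q phi_q) /\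
     bounded_operator I (M_space rho 1 phi) (M_norm rho 1 phi)
                        (WM_space rho q phi_q) (WM_norm rho q phi_q)).
Proof.
move=> M I phi_p phi_q.
have p0 : 0 < p by exact: lt_le_trans hp.
have g0 : 0 < \tr P.
  have : 0 < \tr P / p by exact: lt_trans halphap.
  by rewrite pmulr_lgt0 ?invr_gt0.
have ag : alpha < \tr P.
  by apply: (lt_le_trans halphap); rewrite ler_pdivrMr// ler_peMr// ltW.
have [k [v Q]] := quasi_distance_regular hrho g0.
(* The given C carries no sign; a larger positive constant keeps both conditions, since their
   right-hand sides are nonnegative multiples of C. *)
pose C' := `|C| + 1.
have C'0 : 0 < C' by rewrite ltr_wpDl.
have CC' : C <= C' by rewrite (le_trans (ler_norm C))// lerDl.
have phi_sup' x r : 0 < r -> (ereal_sup [set (t `^ (- \tr P))%:E *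
    ess_inf (mrestr lebesgue_measure (measurable_itv `]t, +oo[))
      (fun tau : R => (phi x tau * tau `^ \tr P)%:E)
    | t in `]r, +oo[] <= (C' * phi x r)%:E)%E.
  move=> r0; apply: (le_trans (phi_sup x r r0)).
  by rewrite lee_fin ler_wpM2r// ltW// phi_pos.
have phi_int' x r : 0 < r -> (\int[lebesgue_measure]_(t in `]r, +oo[)
    (t `^ alpha * phi x t `^ p^-1 / t)%:E
      <= (C' * r `^ (- (alpha * p / (q - p))))%:E)%E.
  move=> r0; apply: (le_trans (phi_int x r r0)).
  by rewrite lee_fin ler_wpM2r// powR_ge0.
have [Mae mM leM] := frac_maximal_dominated Q ag.
have [Iae mI leI] := riesz_potential_dominated Q alpha.
have v0 : 0 < v `^ (- 1 + alpha / \tr P) by rewrite powR_gt0// (rq_v_gt0 Q).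
split=> [p1|p1].
- have psiE x t : 0 < t -> phi_p x t = phi x t `^ p^-1 by [].
  split.
  + exact: (dominated_strong hrho Q hp hpq halpha ag C'0 phi_pos phi_sup' phi_int' psiE
      v0 Mae mM leM p1).
  + exact: (dominated_strong hrho Q hp hpq halpha ag C'0 phi_pos phi_sup' phi_int' psiE
      ltr01 Iae mI leI p1).
(* For p = 1 the source space is stated with phi itself, which agrees with phi^{1/p} because phi is
   positive for t > 0. *)
- have psiE x t : 0 < t -> phi x t = phi x t `^ p^-1.
    by move=> t0; rewrite p1 invr1 powRr1// ltW// phi_pos.
  have W1 := dominated_weak hrho Q hp hpq halpha ag C'0 phi_pos phi_sup' phi_int' psiE
      v0 Mae mM leM p1.
  have W2 := dominated_weak hrho Q hp hpq halpha ag C'0 phi_pos phi_sup' phi_int' psiE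
      ltr01 Iae mI leI p1.
  move: W1 W2; rewrite {psiE}p1 => W1 W2.
  split; [exact: W1|exact: W2].
Qed.
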